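(* (a) Let $f$ be a continuous real-valued function on a compact interval $[a,b]$. Then $f$ is operator convex if and only if the following holds: whenever $h_n\to h$ weakly, where $h_n\in B(\ell^2)_{\mathrm{sa}}$ and $\sigma(h_n)\subset[a,b]$ for all $n$, and $v\in\ell^2$, then $(f(h)v,v)\le\liminf_n (f(h_n)v,v)$. (b) Let $f$ be a continuous real-valued function on an interval $I$. Then $f$ is operator convex if and only if $h\in\mathcal{Q}$ and $\sigma(h)\subset I$ imply $f(h)\in\mathcal{W}$.
   Context: $B(H)_{\mathrm{sa}}$ denotes the self-adjoint bounded operators on the Hilbert space $H$; $\sigma$ denotes the spectrum; functions of self-adjoint operators are defined by the continuous functional calculus. Weak convergence of operators means convergence in the weak operator topology; $(h_n)$ in (a) is a sequence. A continuous real-valued function $f$ on an interval $I$ is operator convex if $f(sh_1+(1-s)h_2)\le s f(h_1)+(1-s)f(h_2)$ for all $s\in[0,1]$ and all $h_1,h_2\in B(H)_{\mathrm{sa}}$ with $\sigma(h_1),\sigma(h_2)\subset I$, for every Hilbert space $H$. Let $E^{**}$ be the set of bounded indexed collections $\{t_n\}_{1\le n\le\infty}$ with each $t_n\in B(\ell^2)$ (the index set is $\{1,2,\dots\}\cup\{\infty\}$), with componentwise operations, and let $E^{**}_{\mathrm{sa}}$ be its self-adjoint elements. For $h=\{h_n\}\in E^{**}_{\mathrm{sa}}$, $\sigma(h)$ is the closure of $\bigcup_{1\le n\le\infty}\sigma(h_n)$, and if $f$ is continuous on a set containing $\sigma(h)$, then $f(h)=\{f(h_n)\}_{1\le n\le\infty}$.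 $\mathcal{Q}$ is the set of $h=\{h_n\}\in E^{**}_{\mathrm{sa}}$ such that $h_n\to h_\infty$ weakly as $n\to\infty$. $\mathcal{W}$ is the set of $h=\{h_n\}\in E^{**}_{\mathrm{sa}}$ such that $(h_\infty v,v)\le\liminf_{n\to\infty}(h_nv,v)$ for each vector $v\in\ell^2$. *)

(* Defs.v *)
Set Warnings "-notation-overridden,-ambiguous-paths".
Set Warnings "-notation-incompatible-prefix".
Set Warnings "-redundant-canonical-projection,-projection-no-head-constant".
From HB Require Import structures.
From mathcomp Require Import all_boot all_order all_algebra.
From mathcomp Require Import all_classical all_reals all_analysis.
From mathcomp Require Import complex ring lra.
Set Implicit Arguments.
Unset Strict Implicit.
Unset Printing Implicit Defensive.
Import Order.TTheory GRing.Theory Num.Theory.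
Import numFieldNormedType.Exports.
Local Open Scope classical_set_scope.
Local Open Scope ring_scope.
Local Open Scope complex_scope.

(* The scalars are R[i]; its topology is the one of the modulus, which
   MathComp-Analysis puts on every numFieldType. *)
HB.instance Definition _ (R : realType) := NormedModule.copy R[i] R[i]^o.

(* Inner products are linear in the first argument. *)
HB.mixin Record NormedModule_isHilbert (R : realType) H
    & CompleteNormedModule R[i] H := {
  inner : {dot H for (@Num.conj R[i])};
  inner_norm : forall x : H, `|x| ^+ 2 = inner x x }.

#[short(type="hilbertType")]
HB.structure Definition Hilbert (R : realType) :=
  {H of NormedModule_isHilbert R H & CompleteNormedModule R[i] H}.

Section BoundedOperators.
Context {R : realType} (H : hilbertType R).

Record bop := Bop {
  bop_fun :> H -> H;
  bop_linear : linear bop_fun;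
  bop_bounded : exists M : R, forall x, `|bop_fun x| <= M%:C * `|x| }.

HB.instance Definition _ (T : bop) :=
  GRing.isLinear.Build R[i] H H _ (bop_fun T) (bop_linear T).

HB.instance Definition _ := gen_eqMixin bop.
HB.instance Definition _ := gen_choiceMixin bop.

Lemma bop_ext (S T : bop) : S =1 T -> S = T.
Proof.
case: S T => [f lf bf] [g lg bg] /= /funext fg.
by rewrite {}fg in lf bf *; congr Bop; exact: Prop_irrelevance.
Qed.

Lemma bop_bounded_pos (T : bop) :
  exists2 M : R, 0 <= M & forall x, `|T x| <= M%:C * `|x|.
Proof.
have [M TM] := bop_bounded T; exists `|M| => // x.
by rewrite (le_trans (TM x))// ler_wpM2r// lecR ler_norm.
Qed.

Program Definition bop0 := @Bop (fun=> 0) _ _.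
Next Obligation. by move=> a x y; rewrite scaler0 addr0. Qed.
Next Obligation. by exists 0 => x; rewrite normr0 mul0r. Qed.

Program Definition bop1 := @Bop id _ _.
Next Obligation. by []. Qed.
Next Obligation. by exists 1 => x; rewrite mul1r. Qed.

Program Definition bop_opp (T : bop) := @Bop (fun x => - T x) _ _.
Next Obligation. by move=> T a x y; rewrite linearP opprD scalerN. Qed.
Next Obligation.
by move=> T; have [M TM] := bop_bounded T; exists M => x; rewrite normrN.
Qed.

Program Definition bop_add (S T : bop) := @Bop (fun x => S x + T x) _ _.
Next Obligation. by move=> S T a x y; rewrite !linearP scalerDr addrACA. Qed.
Next Obligation.
move=> S T; have [M SM] := bop_bounded S; have [N TN] := bop_bounded T.
exists (M + N) => x; rewrite (le_trans (ler_normD _ _))//.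
by rewrite rmorphD/= mulrDl lerD.
Qed.

Program Definition bop_scale (c : R[i]) (T : bop) :=
  @Bop (fun x => c *: T x) _ _.
Next Obligation.
by move=> c T a x y; rewrite linearP scalerDr !scalerA mulrC.
Qed.
Next Obligation.
move=> c T; have [M TM] := bop_bounded T.
exists (ComplexField.Normc.normc c * M) => x.
by rewrite normrZ rmorphM/= -mulrA ler_wpM2l.
Qed.

Program Definition bop_mul (S T : bop) := @Bop (fun x => S (T x)) _ _.
Next Obligation. by move=> S T a x y; rewrite !linearP. Qed.
Next Obligation.
move=> S T; have [M M0 SM] := bop_bounded_pos S; have [N TN] := bop_bounded T.
exists (M * N) => x; rewrite (le_trans (SM _))// rmorphM/= -mulrA.
by rewrite ler_wpM2l// lecR.
Qed.

Fact bop_addA : associative bop_add.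
Proof. by move=> S T U; apply: bop_ext => x /=; rewrite addrA. Qed.
Fact bop_addC : commutative bop_add.
Proof. by move=> S T; apply: bop_ext => x /=; rewrite addrC. Qed.
Fact bop_add0 : left_id bop0 bop_add.
Proof. by move=> S; apply: bop_ext => x /=; rewrite add0r. Qed.
Fact bop_addN : left_inverse bop0 bop_opp bop_add.
Proof. by move=> S; apply: bop_ext => x /=; rewrite addNr. Qed.

HB.instance Definition _ :=
  GRing.isZmodule.Build bop bop_addA bop_addC bop_add0 bop_addN.

Fact bop_mulA : associative bop_mul.
Proof. by move=> S T U; apply: bop_ext. Qed.
Fact bop_mul1l : left_id bop1 bop_mul.
Proof. by move=> S; apply: bop_ext. Qed.
Fact bop_mul1r : right_id bop1 bop_mul.
Proof. by move=> S; apply: bop_ext. Qed.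
Fact bop_mulDl : left_distributive bop_mul +%R.
Proof. by move=> S T U; apply: bop_ext. Qed.
Fact bop_mulDr : right_distributive bop_mul +%R.
Proof. by move=> S T U; apply: bop_ext => x /=; rewrite linearD. Qed.

(* B(H) is the zero ring when H = 0, hence pzRingType. *)
HB.instance Definition _ := GRing.Zmodule_isPzRing.Build bop
  bop_mulA bop_mul1l bop_mul1r bop_mulDl bop_mulDr.

Fact bop_scaleA a b (T : bop) :
  bop_scale a (bop_scale b T) = bop_scale (a * b) T.
Proof. by apply: bop_ext => x /=; rewrite scalerA. Qed.
Fact bop_scale1 : left_id 1 bop_scale.
Proof. by move=> T; apply: bop_ext => x /=; rewrite scale1r. Qed.
Fact bop_scaleDr : right_distributive bop_scale +%R.
Proof. by move=> a S T; apply: bop_ext => x /=; rewrite scalerDr. Qed.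
Fact bop_scaleDl (T : bop) : {morph bop_scale^~ T : a b / a + b}.
Proof. by move=> a b; apply: bop_ext => x /=; rewrite scalerDl. Qed.

HB.instance Definition _ := GRing.Zmodule_isLmodule.Build R[i] bop
  bop_scaleA bop_scale1 bop_scaleDr bop_scaleDl.

End BoundedOperators.

Section SpectralNotions.
Context {R : realType} {H : hilbertType R}.
Implicit Types (S T h : bop H) (f : R -> R).

Definition selfadjoint T := forall x y : H, inner (T x) y = inner x (T y).

Definition spectrum T : set R[i] := [set lam : R[i] |
  ~ exists S, let lamT := lam *: (1 : bop H) - T in
     S * lamT = 1 /\ lamT * S = 1].

(* The spectrum is a set of complex numbers, so that "the spectrum of h is
   contained in I", for I a set of reals, is spectrum h `<=` real_set I. *)
Definition real_set (I : set R) : set R[i] := [set x%:C | x in I].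

Definition bop_le S T := forall v : H, inner (S v) v <= inner (T v) v.

Definition bop_poly (p : {poly R}) T : bop H :=
  \sum_(k < size p) (p`_k)%:C *: T ^+ k.

(* The continuous functional calculus of a self-adjoint h: f(h) is the norm
   limit of p(h) for polynomials p converging to f uniformly on the spectrum. *)
Definition is_cfc f h T := forall e : R, 0 < e -> exists p : {poly R},
  (forall x : R, spectrum h x%:C -> `|p.[x] - f x| <= e) /\
  (forall v : H, `|(bop_poly p h - T) v| <= e%:C * `|v|).

(* is_cfc f h holds of exactly one operator when h is self-adjoint and f is
   continuous on its spectrum; otherwise the value 0 is a dummy. *)
Definition cfc f h : bop H := xget 0 [set T | is_cfc f h T].

Definition weak_cvg (h_ : nat -> bop H) h :=
  forall x y : H, inner (h_ n x) y @[n --> \oo] --> inner (h x) y.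

(* (T v, v), a real number for self-adjoint T *)
Definition qform T (v : H) : R := complex.Re (inner (T v) v).

End SpectralNotions.

Definition operator_convex {R : realType} (I : set R) (f : R -> R) :=
  forall (H : hilbertType R) (h1 h2 : bop H) (s : R),
    selfadjoint h1 -> selfadjoint h2 ->
    spectrum h1 `<=` real_set I -> spectrum h2 `<=` real_set I ->
    0 <= s <= 1 ->
    bop_le (cfc f (s%:C *: h1 + (1 - s)%:C *: h2))
           (s%:C *: cfc f h1 + (1 - s)%:C *: cfc f h2).


Section ComplexLimits.
Context {R : realType}.
Implicit Types (z w : R[i]).

Lemma real_complex_cvg {T : Type} {F : set_system T} {FF : Filter F}
    (f : T -> R) (a : R) :
  f t @[t --> F] --> a -> (f t)%:C @[t --> F] --> (a%:C : R[i]).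
Proof.
move=> fa; apply/cvgrPdist_le => -[e1 e2].
rewrite ltcE/= => /andP[/eqP -> e0].
move/cvgrPdist_le : fa => /(_ _ e0); apply: filterS => t /= fte.
by rewrite -rmorphB/= normc_def/= expr0n/= addr0 sqrtr_sqr lecR.
Qed.

Lemma complex_cvg {T : Type} {F : set_system T} {FF : Filter F}
    (f : T -> R[i]) (a b : R) :
  complex.Re (f t) @[t --> F] --> a -> complex.Im (f t) @[t --> F] --> b ->
  f t @[t --> F] --> a +i* b.
Proof.
move=> fa fb.
have -> : a +i* b = a%:C + 'i%C * b%:C.
  by apply/eqP; rewrite eq_complex/= !(mul0r, mul1r, subr0, addr0, add0r) !eqxx.
have -> : f = fun t => (complex.Re (f t))%:C + 'i%C * (complex.Im (f t))%:C.
  apply/funext => t; case: (f t) => c d; apply/eqP.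
  by rewrite eq_complex/= !(mul0r, mul1r, subr0, addr0, add0r) !eqxx.
apply: cvgD; first exact: real_complex_cvg.
by apply: cvgMl_tmp; exact: real_complex_cvg.
Qed.

End ComplexLimits.

Section SquareSummable.
Context {R : realType}.
Implicit Types (x y : nat -> R[i]) (z w : R[i]).
Local Notation normc := ComplexField.Normc.normc.

Definition sqmod z : R := normc z ^+ 2.

Lemma sqmod_ge0 z : 0 <= sqmod z. Proof. exact: sqr_ge0. Qed.

Lemma sqmodE z : (sqmod z)%:C = z * Num.conj z.
Proof. by rewrite /sqmod rmorphXn/= -normCK. Qed.

Lemma sqmod_eq0 z : sqmod z = 0 -> z = 0.
Proof.
by move=> /eqP; rewrite sqrf_eq0 => /eqP /ComplexField.Normc.eq0_normc.
Qed.

Lemma sqmodM z w : sqmod (z * w) = sqmod z * sqmod w.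
Proof. by rewrite /sqmod ComplexField.Normc.normcM exprMn. Qed.

Lemma sqmodReIm z : sqmod z = complex.Re z ^+ 2 + complex.Im z ^+ 2.
Proof. by case: z => a b; rewrite /sqmod/= sqr_sqrtr// addr_ge0// sqr_ge0. Qed.

Lemma sqmodD (t : R) z w : 0 < t ->
  sqmod (z + w) <= (1 + t) * sqmod z + (1 + t^-1) * sqmod w.
Proof.
move=> t0; rewrite !sqmodReIm.
case: z w => [a b] [c d] /=.
have sq (p q : R) : (p + q) ^+ 2 <= (1 + t) * p ^+ 2 + (1 + t^-1) * q ^+ 2.
  rewrite -subr_ge0; have -> : (1 + t) * p ^+ 2 + (1 + t^-1) * q ^+ 2 -
      (p + q) ^+ 2 = t * (p - t^-1 * q) ^+ 2 by field; rewrite gt_eqF.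
  by rewrite mulr_ge0 ?sqr_ge0 // ltW.
by have := sq a c; have := sq b d; lra.
Qed.

Definition square_summable x := cvgn (series (fun n => sqmod (x n))).

Definition sqsum x : R := limn (series (fun n => sqmod (x n))).

Lemma sqseries_nd x : nondecreasing_seq (series (fun n => sqmod (x n))).
Proof. by apply: nondecreasing_series => n _ _; exact: sqmod_ge0. Qed.

Lemma sqsum_ge x n : square_summable x ->
  series (fun n => sqmod (x n)) n <= sqsum x.
Proof. by move=> sx; exact: (nondecreasing_cvgn_le (sqseries_nd x) sx). Qed.

Lemma sqsum_ge0 x : square_summable x -> 0 <= sqsum x.
Proof.
by move=> /(sqsum_ge 0); rewrite /series/= big_geq.
Qed.

Lemma sqsum_bounded x (M : R) :
  (forall n, series (fun n => sqmod (x n)) n <= M) ->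
  square_summable x /\ sqsum x <= M.
Proof.
move=> xM; have sx : square_summable x.
  apply: nondecreasing_is_cvgn; first exact: sqseries_nd.
  by exists M => _ [n _ <-]; exact: xM.
by split => //; apply: limr_le => //; near=> n; exact: xM.
Unshelve. all: by end_near. Qed.

Lemma sqsum0 : square_summable 0 /\ sqsum 0 = 0.
Proof.
have [s0 le0] : square_summable 0 /\ sqsum 0 <= 0.
  apply: sqsum_bounded => n; rewrite /series/= big1// => k _.
  by rewrite sqmodReIm/= expr0n addr0.
by split => //; apply/eqP; rewrite eq_le le0 sqsum_ge0.
Qed.

Lemma sqsum_eq0 x : square_summable x -> sqsum x = 0 -> x = 0.
Proof.
move=> sx x0; apply/funext => k; apply: sqmod_eq0; apply/eqP.
rewrite eq_le sqmod_ge0 andbT -x0 (le_trans _ (sqsum_ge k.+1 sx))//.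
rewrite /series/= big_nat_recr//= lerDr sumr_ge0// => i _.
exact: sqmod_ge0.
Qed.

Lemma sqsumZ (a : R[i]) x : square_summable x ->
  square_summable (a *: x) /\ sqsum (a *: x) = sqmod a * sqsum x.
Proof.
move=> sx; have E : series (fun n => sqmod ((a *: x) n)) =
    fun n => sqmod a * series (fun n => sqmod (x n)) n.
  apply/funext => n; rewrite /series/= mulr_sumr.
  by apply: eq_bigr => k _; rewrite -sqmodM.
have c : series (fun n => sqmod ((a *: x) n)) @ \oo --> sqmod a * sqsum x.
  by rewrite E; apply: cvgMl_tmp; exact: sx.
by split; [apply/cvg_ex; eexists; exact: c | exact: cvg_lim c].
Qed.

Lemma sqsumD (t : R) x y : 0 < t -> square_summable x -> square_summable y ->
  square_summable (x + y) /\
  sqsum (x + y) <= (1 + t) * sqsum x + (1 + t^-1) * sqsum y.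
Proof.
move=> t0 sx sy; apply: sqsum_bounded => n.
apply: (@le_trans _ _ ((1 + t) * series (fun n => sqmod (x n)) n +
  (1 + t^-1) * series (fun n => sqmod (y n)) n)).
  by rewrite /series/= !mulr_sumr -big_split/= ler_sum// => k _; exact: sqmodD.
by rewrite lerD// ler_pM2l ?sqsum_ge// addr_gt0// invr_gt0.
Qed.

Lemma sqrt_sqsumD x y : square_summable x -> square_summable y ->
  Num.sqrt (sqsum (x + y)) <= Num.sqrt (sqsum x) + Num.sqrt (sqsum y).
Proof.
move=> sx sy.
have [x0|x0] := eqVneq (sqsum x) 0.
  by rewrite (sqsum_eq0 sx x0) add0r sqsum0.2 sqrtr0 add0r.
have [y0|y0] := eqVneq (sqsum y) 0.
  by rewrite (sqsum_eq0 sy y0) addr0 sqsum0.2 sqrtr0 addr0.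
have p0 : 0 < Num.sqrt (sqsum x) by rewrite sqrtr_gt0 lt_def x0 sqsum_ge0.
have q0 : 0 < Num.sqrt (sqsum y) by rewrite sqrtr_gt0 lt_def y0 sqsum_ge0.
have t0 : 0 < Num.sqrt (sqsum y) / Num.sqrt (sqsum x) by rewrite divr_gt0.
have [_] := sqsumD t0 sx sy.
rewrite -{2}(sqr_sqrtr (sqsum_ge0 sx)) -{3}(sqr_sqrtr (sqsum_ge0 sy)).
move: p0 q0; set p := Num.sqrt (sqsum x); set q := Num.sqrt (sqsum y) => p0 q0.
have -> : (1 + q / p) * p ^+ 2 + (1 + (q / p)^-1) * q ^+ 2 = (p + q) ^+ 2.
  by field; rewrite !gt_eqF.
move=> h; rewrite -[leRHS]ger0_norm; last by rewrite addr_ge0// ltW.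
rewrite -sqrtr_sqr.
exact: ler_wsqrtr.
Qed.

Lemma product_summable x y : square_summable x -> square_summable y ->
  cvgn (series (fun n => x n * Num.conj (y n))).
Proof.
move=> sx sy; set u := fun n => _.
have su : cvgn (series (fun n => normc (u n))).
  apply: (@series_le_cvg _ _ (fun n => sqmod (x n) + sqmod (y n))).
  - by move=> n; case: (u n) => a b /=; rewrite sqrtr_ge0.
  - by move=> n; rewrite addr_ge0 ?sqmod_ge0.
  - move=> n; rewrite /u ComplexField.Normc.normcM.
    have -> : normc (Num.conj (y n)) = normc (y n).
      by case: (y n) => a b /=; rewrite sqrrN.
    rewrite /sqmod; nra.
  - have -> : series (fun n => sqmod (x n) + sqmod (y n)) =
        series (fun n => sqmod (x n)) \+ series (fun n => sqmod (y n)).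
      by apply/funext => n; rewrite /series/= big_split.
    exact: is_cvgD.
have reim (g : R[i] -> R) : g 0 = 0 -> {morph g : a b / a + b} ->
    (forall z, `|g z| <= normc z) -> cvgn (fun n => g (series u n)).
  move=> g0 gD gle; have -> : (fun n => g (series u n)) = series (g \o u).
    by apply/funext => n; rewrite /series/= (big_morph g gD g0).
  apply: normed_cvg; apply: series_le_cvg su => n //=.
  by rewrite (le_trans _ (gle _)).
apply/cvg_ex; eexists; apply: complex_cvg.
- apply: (reim (@complex.Re R)) => // [[a b] [c d]//|[a b]/=].
  by rewrite -sqrtr_sqr ler_wsqrtr// lerDl sqr_ge0.
- apply: (reim (@complex.Im R)) => // [[a b] [c d]//|[a b]/=].
  by rewrite -sqrtr_sqr ler_wsqrtr// lerDr sqr_ge0.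
Qed.

End SquareSummable.

Section L2.
Context (R : realType).
Local Notation normc := ComplexField.Normc.normc.

Definition l2_pred : {pred nat -> R[i]} := fun x => `[< square_summable x >].

Lemma l2_submod_closed : submod_closed l2_pred.
Proof.
split; first exact/asboolP/sqsum0.1.
move=> a x y /asboolP sx /asboolP sy; apply/asboolP.
exact: (sqsumD ltr01 (sqsumZ a sx).1 sy).1.
Qed.

HB.instance Definition _ :=
  GRing.isSubmodClosed.Build R[i] (nat -> R[i]) l2_pred l2_submod_closed.

Record l2 := L2 { l2_val :> nat -> R[i]; l2_valP : l2_val \in l2_pred }.

HB.instance Definition _ := [isSub for l2_val].
HB.instance Definition _ := [Choice of l2 by <:].
HB.instance Definition _ := [SubChoice_isSubLmodule of l2 by <:].

Lemma l2_summable (x : l2) : square_summable x.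
Proof. exact/asboolP/(l2_valP x). Qed.
Arguments l2_summable : clear implicits.

Definition l2_norm (x : l2) : R[i] := (Num.sqrt (sqsum x))%:C.

Fact l2_ler_normD (x y : l2) : l2_norm (x + y) <= l2_norm x + l2_norm y.
Proof.
rewrite /l2_norm -rmorphD/= lecR.
exact: sqrt_sqsumD (l2_summable x) (l2_summable y).
Qed.

Fact l2_normZ (a : R[i]) (x : l2) : l2_norm (a *: x) = `|a| * l2_norm x.
Proof.
rewrite /l2_norm (sqsumZ a (l2_summable x)).2 sqrtrM ?sqmod_ge0//.
rewrite rmorphM/=; congr (_ * _); rewrite sqrtr_sqr ger0_norm//.
by case: a => a b /=; rewrite sqrtr_ge0.
Qed.

Fact l2_norm0_eq0 (x : l2) : l2_norm x = 0 -> x = 0.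
Proof.
move=> /(congr1 (@complex.Re R))/= /eqP; rewrite sqrtr_eq0 => x0.
apply: val_inj; apply: (sqsum_eq0 (l2_summable x)).
by apply/eqP; rewrite eq_le x0 sqsum_ge0//; exact: l2_summable.
Qed.

HB.instance Definition _ := Lmodule_isNormed.Build R[i] l2
  l2_ler_normD l2_normZ l2_norm0_eq0.

Lemma l2_norm_le (x : l2) (e : R) : 0 <= e ->
  (`|x| <= e%:C) = (sqsum x <= e ^+ 2).
Proof.
move=> e0; rewrite [`|x|]/(l2_norm x) lecR.
by rewrite -(ler_sqrt _ (sqr_ge0 e)) sqrtr_sqr ger0_norm.
Qed.

Lemma l2_complete (F : set_system l2) : ProperFilter F -> cauchy F -> cvg F.
Proof.
move=> FF /cauchy_ballP Fc.
have {}Fc (e : R) : 0 < e -> exists2 A : set l2, F A &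
    forall x y, A x -> A y -> sqsum (x - y : l2) <= e ^+ 2.
  move=> e0; have e0' : 0 < (e%:C : R[i]) by rewrite ltcR.
  have [[A B] /= [FA FB] AB] := Fc _ e0'.
  exists (A `&` B); first exact: filterI.
  move=> x y [Ax _] [_ By]; have := AB (x, y) (conj Ax By).
  by rewrite /= -ball_normE/= => /ltW; rewrite l2_norm_le// ltW.
have coord_le (x y : l2) k : sqmod (x k - y k) <= sqsum (x - y : l2).
  rewrite (le_trans _ (sqsum_ge k.+1 (l2_summable (x - y))))//.
  rewrite /series/= big_nat_recr//= lerDr sumr_ge0// => i _.
  exact: sqmod_ge0.
have coord (g : R[i] -> R) k : (forall z w, g z - g w = g (z - w)) ->
    (forall z, g z ^+ 2 <= sqmod z) -> cvg ((fun x : l2 => g (x k)) @ F).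
  move=> gB gle; apply/cauchy_cvgP/cauchy_ballP => e e0.
  have [|A FA AP] := Fc (e / 2); first by rewrite divr_gt0.
  pose B := [set g (x k) | x in A].
  have FB : F [set x : l2 | B (g (x k))] by apply: filterS FA => x Ax; exists x.
  exists (B, B); first by split.
  move=> [_ _] [/= [x Ax <-] [y Ay <-]]; rewrite -ball_normE/= gB.
  rewrite (@le_lt_trans _ _ (e / 2))//; last by rewrite ltr_pdivrMr ?ltr_pMr// ltr1n.
  have e2 : 0 <= e / 2 by rewrite divr_ge0 ?ltW.
  rewrite -(ler_pXn2r (ltn0Sn 1)) ?nnegrE// real_normK ?num_real//.
  rewrite (le_trans (gle _))// (le_trans (coord_le _ _ _))//; exact: AP.
pose a k := lim ((fun x : l2 => complex.Re (x k)) @ F).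
pose b k := lim ((fun x : l2 => complex.Im (x k)) @ F).
pose y : nat -> R[i] := fun k => a k +i* b k.
have ca k : (fun x : l2 => complex.Re (x k)) @ F --> a k.
  apply: (coord (@complex.Re R)) => [[? ?] [? ?]//|z].
  by rewrite sqmodReIm lerDl sqr_ge0.
have cb k : (fun x : l2 => complex.Im (x k)) @ F --> b k.
  apply: (coord (@complex.Im R)) => [[? ?] [? ?]//|z].
  by rewrite sqmodReIm lerDr sqr_ge0.
have key (e : R) : 0 < e -> exists2 A : set l2, F A & forall x : l2, A x ->
    square_summable ((x : nat -> R[i]) - y) /\
    sqsum ((x : nat -> R[i]) - y) <= e ^+ 2.
  move=> e0; have [A FA AP] := Fc _ e0; exists A => // x Ax.
  apply: sqsum_bounded => n.
  have c : (fun z : l2 => series (fun k => sqmod (x k - z k)) n) @ F -->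
      series (fun k => sqmod (x k - y k)) n.
    rewrite /series/=; apply: cvg_big => [|k _]; first exact: add_continuous.
    have reB z w : complex.Re (z - w : R[i]) = complex.Re z - complex.Re w.
      by case: z w => [? ?] [? ?].
    have imB z w : complex.Im (z - w : R[i]) = complex.Im z - complex.Im w.
      by case: z w => [? ?] [? ?].
    rewrite sqmodReIm reB imB !expr2.
    under eq_fun do rewrite sqmodReIm reB imB !expr2.
    by apply: cvgD; apply: cvgM; (apply: cvgB; [exact: cvg_cst|]).
  apply: (cvgr_to_le c); apply: filterS FA => z Az.
  exact: le_trans (sqsum_ge n (l2_summable (x - z))) (AP _ _ Ax Az).
have [A FA AP] := key _ ltr01.
have [x Ax] := filter_ex FA.
have yl2 : y \in l2_pred.
  have -> : y = (x : nat -> R[i]) - ((x : nat -> R[i]) - y) by rewrite subKr.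
  by rewrite rpredB//; [exact: l2_valP | exact/asboolP/(AP _ Ax).1].
apply/cvg_ex; exists (L2 yl2); apply/cvgrPdist_le => -[e1 e2].
rewrite ltcE/= => /andP[/eqP -> e0].
have [B FB BP] := key _ e0.
apply: filterS FB => z Bz /=; rewrite distrC l2_norm_le; last exact: ltW.
exact: (BP _ Bz).2.
Qed.

HB.instance Definition _ := Uniform_isComplete.Build l2 l2_complete.

Definition l2_inner (x y : l2) : R[i] :=
  limn (series (fun n => x n * Num.conj (y n))).

Lemma l2_inner_cvg (x y : l2) :
  series (fun n => x n * Num.conj (y n)) @ \oo --> l2_inner x y.
Proof. exact: product_summable (l2_summable x) (l2_summable y). Qed.
Arguments l2_inner_cvg : clear implicits.

Lemma l2_inner_linearl (y : l2) : GRing.linear_for *%R (l2_inner^~ y).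
Proof.
move=> a u v; apply: cvg_lim => //.
have -> : series (fun n => (a *: u + v) n * Num.conj (y n)) =
    (fun n => a * series (fun n => u n * Num.conj (y n)) n) \+
    series (fun n => v n * Num.conj (y n)).
  apply/funext => n; rewrite /series/= mulr_sumr -big_split/=.
  by apply: eq_bigr => k _; rewrite -[(_ + _) k]/(a * u k + v k) mulrDl mulrA.
by apply: cvgD; [apply: cvgMl_tmp|]; exact: l2_inner_cvg.
Qed.

Lemma l2_inner_conj (x y : l2) : l2_inner x y = Num.conj (l2_inner y x).
Proof.
apply: cvg_lim => //.
have -> : series (fun n => x n * Num.conj (y n)) =
    fun n => Num.conj (series (fun n => y n * Num.conj (x n)) n).
  apply/funext => n; rewrite /series/= rmorph_sum/=.
  by apply: eq_bigr => k _; rewrite rmorphM/= conjCK mulrC.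
apply/cvgrPdist_le => e e0.
move/cvgrPdist_le : (l2_inner_cvg y x) => /(_ _ e0).
by apply: filterS => n; rewrite -rmorphB/= norm_conjC.
Qed.

Lemma l2_inner_linearr (x : l2) :
  GRing.linear_for (@Num.conj R[i] \; *%R) (l2_inner x).
Proof.
move=> a u v; rewrite l2_inner_conj l2_inner_linearl rmorphD rmorphM/=.
by rewrite -!l2_inner_conj.
Qed.

Lemma l2_inner_sqsum (x : l2) : l2_inner x x = (sqsum x)%:C.
Proof.
apply: cvg_lim => //.
have -> : series (fun n => x n * Num.conj (x n)) =
    fun n => (series (fun n => sqmod (x n)) n)%:C.
  apply/funext => n; rewrite /series/= rmorph_sum/=.
  by apply: eq_bigr => k _; rewrite sqmodE.
by apply: real_complex_cvg; exact: l2_summable.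
Qed.

Lemma l2_inner_norm (x : l2) : `|x| ^+ 2 = l2_inner x x.
Proof.
rewrite l2_inner_sqsum [`|x|]/(l2_norm x) -rmorphXn/= sqr_sqrtr//.
exact: sqsum_ge0 (l2_summable x).
Qed.

HB.instance Definition _ := bilinear_isBilinear.Build R[i] l2 l2 R[i] *%R
  (@Num.conj R[i] \; *%R) l2_inner (l2_inner_linearl, l2_inner_linearr).

Fact l2_inner_herm (x y : l2) :
  l2_inner x y = (-1) ^+ false * Num.conj (l2_inner y x).
Proof. by rewrite mul1r l2_inner_conj. Qed.

HB.instance Definition _ := isHermitianSesquilinear.Build R[i] l2 false
  (@Num.conj R[i]) l2_inner l2_inner_herm.

Fact l2_inner_gt0 (x : l2) : x != 0 -> 0 < l2_inner x x.
Proof. by move=> x0; rewrite -l2_inner_norm exprn_gt0// normr_gt0. Qed.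

HB.instance Definition _ := isDotProduct.Build R[i] l2 l2_inner l2_inner_gt0.

HB.instance Definition _ := NormedModule_isHilbert.Build R l2 l2_inner_norm.

End L2.

Section BoundedCollections.
Context {R : realType}.

(* The index set {1, 2, ...} together with infinity is option nat: None is
   infinity, and Some n is the index n + 1. *)
Definition Estarstar : set (option nat -> bop (l2 R)) :=
  [set t | exists M : R, forall n v, `|t n v| <= M%:C * `|v|].

Definition Estarstar_sa : set (option nat -> bop (l2 R)) :=
  [set h | Estarstar h /\ forall n, selfadjoint (h n)].

Definition Espectrum (h : option nat -> bop (l2 R)) : set R[i] :=
  closure (\bigcup_n spectrum (h n)).

Definition Ecfc (f : R -> R) (h : option nat -> bop (l2 R)) :
  option nat -> bop (l2 R) := fun n => cfc f (h n).

Definition Qset : set (option nat -> bop (l2 R)) :=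
  [set h | Estarstar_sa h /\ weak_cvg (fun n => h (Some n)) (h None)].

Definition Wset : set (option nat -> bop (l2 R)) :=
  [set h | Estarstar_sa h /\ forall v : l2 R,
    ((qform (h None) v)%:E <= limn_einf (fun n => (qform (h (Some n)) v)%:E))%E].

End BoundedCollections.

(* Main.v *)
Require Import Defs.
From HB Require Import structures.
From mathcomp Require Import all_boot all_order all_algebra.
From mathcomp Require Import all_classical all_reals all_analysis.
From mathcomp Require Import complex ring lra.
Import Order.TTheory GRing.Theory Num.Theory.
Import numFieldNormedType.Exports.
Set Implicit Arguments.
Unset Strict Implicit.
Unset Printing Implicit Defensive.
Local Open Scope classical_set_scope.
Local Open Scope ring_scope.
Local Open Scope complex_scope.

(** From convexity to semicontinuity. Suppose that h_n -> h weakly, that all the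
   spectra lie in [a, b], and that (f(h_n) v, v) < c for infinitely many n. The
   self-adjoint k with a <= k <= b and (f(k) v, v) <= c form a convex set, by
   operator convexity, and h is in the weak closure of that set. By Mazur's
   theorem h is then in its strong closure; since f is a uniform limit of
   polynomials and polynomials are strongly continuous on bounded sets,
   (f(h) v, v) <= c. The ingredients are [mazur_strong_approximation],
   [bop_poly_strong] and [cfc_qform_approx], and the result is
   [operator_convex_weakly_lsc].

   From semicontinuity to convexity. Let h1 and h2 be self-adjoint on an arbitrary
   Hilbert space H, k := s h1 + (1 - s) h2 and v in H. A polynomial p uniformly
   close to f on [a, b] only sees the finitely many vectors h1^i v, h2^i v, k^i v,
   so H may be compressed to their span, which embeds in l^2. In the plane spanned
   by delta_0 and a far away delta_N, let e_N be the projection onto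
   sqrt s delta_0 + sqrt (1 - s) delta_N. The operators
   h1 (x) e_N + h2 (x) (1 - e_N) converge weakly, as N grows, to an operator that
   acts as k on the vectors v (x) delta_0, while the quadratic form of
   f(h1) (x) e_N + f(h2) (x) (1 - e_N) at v (x) delta_0 is
   s (f(h1) v, v) + (1 - s) (f(h2) v, v) for all N. Semicontinuity then is the
   convexity inequality. The [block_op] below are these operators on v (x) delta_0
   and v (x) delta_N, with the scalar a everywhere else; [block_op_weak_cvg] is their
   convergence, and the result is [weakly_lsc_convex].

   For an interval I, the infimum and the supremum of the numerical range of a
   self-adjoint operator belong to its spectrum ([spectrum_extremes]). Both sides
   of the second equivalence are therefore statements about the compact segments
   contained in I ([operator_convex_local], [bounded_collection_extremes]).

   The functional calculus rests on the following facts about a self-adjoint h: its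
   spectrum lies in [a, b] exactly when a <= h <= b ([numrange_spectrum] and
   [spectrum_numrange]), the spectral mapping theorem for polynomials
   ([spectrum_bop_poly]), the resulting bound of the norm of p(h) by the supremum of
   |p| on the spectrum ([bop_poly_opnorm]), and polynomial approximation
   ([weierstrass], by Bernstein polynomials). *)

(** * The Weierstrass approximation theorem *)

Section Weierstrass.
Context {R : realType}.
Implicit Types (f : R -> R) (g : nat -> R).

(** The Bernstein polynomial of degree n in X of the values g 0, ..., g n: the mean of
   g over a binomial variable with n trials of probability X, computed by
   conditioning on one trial. No binomial coefficient is needed in this form. *)
Fixpoint bernstein (X : {poly R}) n g : {poly R} :=
  if n is m.+1 then (1 - X) * bernstein X m g + X * bernstein X m (g \o S)
  else (g 0%N)%:P.

Lemma bernsteinD X n g1 g2 :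
  bernstein X n (fun k => g1 k + g2 k) = bernstein X n g1 + bernstein X n g2.
Proof.
elim: n g1 g2 => [|n IH] g1 g2 /=; first by rewrite polyCD.
by rewrite IH (IH (g1 \o S) (g2 \o S)) !mulrDr addrACA.
Qed.

Lemma bernsteinZ X n c g :
  bernstein X n (fun k => c * g k) = c *: bernstein X n g.
Proof.
elim: n g => [|n IH] g /=; first by rewrite polyCM mul_polyC.
by rewrite IH (IH (g \o S)) scalerDr !scalerAr.
Qed.

Lemma bernstein_cst X n c : bernstein X n (fun=> c) = c%:P.
Proof.
elim: n => //= n IH; rewrite -[bernstein X n (_ \o _)]/(bernstein X n (fun=> c)).
by rewrite IH -mulrDl subrK mul1r.
Qed.

Lemma bernstein_le X n g1 g2 x : 0 <= X.[x] <= 1 ->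
  (forall k, (k <= n)%N -> g1 k <= g2 k) ->
  (bernstein X n g1).[x] <= (bernstein X n g2).[x].
Proof.
move=> /andP[X0 X1]; elim: n g1 g2 => [|n IH] g1 g2 g12 /=.
  by rewrite !hornerE; exact: g12.
rewrite !hornerE lerD// ler_wpM2l ?subr_ge0//.
- by apply: IH => k kn; apply: g12; exact: leqW.
- by apply: IH => k kn; exact: g12.
Qed.

(** The second moment about c of a binomial variable: variance n X (1 - X) plus the
   square of the bias. *)
Lemma bernstein_variance X n c x :
  (bernstein X n (fun k => (k%:R - c) ^+ 2)).[x] =
  n%:R * (X.[x] * (1 - X.[x])) + (n%:R * X.[x] - c) ^+ 2.
Proof.
elim: n c => [|n IH] c /=; first by rewrite !hornerE.
have -> : (fun k => (k%:R - c) ^+ 2) \o S = fun k : nat => (k%:R - (c - 1)) ^+ 2.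
  by apply/funext => k /=; rewrite -[k.+1]addn1 natrD; ring.
have X1 : (1 - X).[x] = 1 - X.[x] by rewrite !hornerE.
by rewrite hornerD !hornerM X1 !IH -[n.+1]addn1 natrD; ring.
Qed.

Lemma uniform_continuity_segment a b f (e : R) :
  {within `[a, b], continuous f} -> 0 < e ->
  exists2 d, 0 < d & forall x y, x \in `[a, b] -> y \in `[a, b] ->
    `|x - y| < d -> `|f x - f y| <= e.
Proof.
move=> cf e0.
have /compact_near_coveringP/near_covering_withinP nc := @segment_compact R a b.
have [|d /= d0 dP] := nc R (0^'+)
    (fun d x => forall y, y \in `[a, b] -> `|x - y| < d -> `|f x - f y| <= e) _.
  move=> x xab.
  have : {for (x : subspace `[a, b]), continuous (f : subspace `[a, b] -> R)}.
    exact: cf.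
  move=> /cvgrPdist_lt /(_ (e / 2)); rewrite divr_gt0// => /(_ isT).
  rewrite /prop_near1 /nbhs/= -nbhs_subspace_in; last exact: xab.
  move=> -[r /= r0 rP].
  exists (ball x (r / 2), [set d | d < r / 2]) => /=.
    split; first by apply: nbhsx_ballx; rewrite divr_gt0.
    by apply: nbhs_right_lt; rewrite divr_gt0.
  move=> [z d] /= [xz dr] zab y yab zy.
  rewrite (_ : f z - f y = (f x - f y) - (f x - f z)); last by ring.
  rewrite (splitr e) (le_trans (ler_normB _ _))// lerD// ltW//.
  - apply: rP => //=; rewrite (splitr r) (_ : x - y = (x - z) + (z - y)); last by ring.
    by rewrite (le_lt_trans (ler_normD _ _))// ltrD// (lt_trans zy).
  - apply: rP => //=; apply: lt_trans xz _; rewrite ltr_pdivrMr// ltr_pMr// ltr1n//.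
exists (d / 2); first by rewrite divr_gt0.
move=> x y xab yab xy; apply: (dP (d / 2)) => //=.
- by rewrite sub0r normrN gtr0_norm ?divr_gt0// ltr_pdivrMr// ltr_pMr// ltr1n//.
- by rewrite divr_gt0.
Qed.

Lemma continuous_segment_bounded a b f : {within `[a, b], continuous f} ->
  exists2 M, 0 <= M & forall x, x \in `[a, b] -> `|f x| <= M.
Proof.
move=> cf; have /(continuous_compact cf) /compact_bounded := @segment_compact R a b.
move=> [M [_ MP]]; exists (`|M| + 1) => [|x xab].
  by rewrite addr_ge0.
by apply: (MP (`|M| + 1)); [rewrite ltr_pwDr// ler_norm | exists x].
Qed.

Theorem weierstrass a b f (e : R) : a <= b ->
  {within `[a, b], continuous f} -> 0 < e ->
  exists p : {poly R}, forall x, x \in `[a, b] -> `|p.[x] - f x| <= e.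
Proof.
rewrite le_eqVlt => /predU1P[<- _ e0|ab cf e0].
  exists (f a)%:P => x; rewrite in_itv/= => /andP[ax xa].
  have -> : x = a by apply/eqP; rewrite eq_le xa.
  by rewrite hornerC subrr normr0 ltW.
have [M M0 fM] := continuous_segment_bounded cf.
have e2 : 0 < e / 2 by rewrite divr_gt0.
have [d d0 fd] := uniform_continuity_segment cf e2.
have ba : 0 < b - a by rewrite subr_gt0.
(* C makes the quadratic bound fC hold both near the diagonal, by uniform
   continuity, and at distance at least d, where |f| <= M suffices. *)
pose C := 2 * M / d ^+ 2.
have C0 : 0 <= C by rewrite divr_ge0 ?sqr_ge0// mulr_ge0.
have fC x y : x \in `[a, b] -> y \in `[a, b] ->
    `|f x - f y| <= e / 2 + C * (x - y) ^+ 2.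
  move=> xab yab; have [xyd|dxy] := ltP `|x - y| d.
    by rewrite (le_trans (fd _ _ xab yab xyd))// lerDl mulr_ge0// sqr_ge0.
  apply: (@le_trans _ _ (2 * M)).
    rewrite (le_trans (ler_normB _ _))// mulr_natl mulr2n.
    by rewrite lerD// fM.
  apply: (@le_trans _ _ (C * (x - y) ^+ 2)); last by rewrite lerDr ltW.
  rewrite /C -mulrA ler_peMr ?mulr_ge0//.
  rewrite mulrC ler_pdivlMr ?exprn_gt0// mul1r -[leRHS]real_normK ?num_real//.
  by rewrite ler_sqr ?nnegrE// ltW.
pose X : {poly R} := (b - a)^-1 *: ('X - a%:P).
(* The variance of the nodes is at most (b - a)^2 / n; this n makes C times it at most
   e / 2. *)
pose n := (Num.truncn (C * (b - a) ^+ 2 / (e / 2))).+1.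
have n0 : 0 < n%:R :> R by rewrite ltr0n.
have nC : C * (b - a) ^+ 2 <= n%:R * (e / 2).
  rewrite -ler_pdivrMr//; apply/ltW; rewrite /n; exact: truncnS_gt.
pose g k := f (a + (b - a) * (k%:R / n%:R)).
exists (bernstein X n g) => x xab.
have /andP[ax xb] : a <= x <= b by rewrite in_itv/= in xab.
have Xx : X.[x] = (x - a) / (b - a) by rewrite !hornerE mulrC.
have X01 : 0 <= X.[x] <= 1.
  rewrite Xx divr_ge0 ?subr_ge0 ?(ltW ab)//= ler_pdivrMr// mul1r.
  by rewrite lerD2r.
pose v k := C * ((b - a) / n%:R) ^+ 2 * (k%:R - n%:R * X.[x]) ^+ 2.
have bv : (bernstein X n (fun k => e / 2 + v k)).[x] <= e.
  rewrite bernsteinD bernstein_cst bernsteinZ hornerD hornerC hornerZ bernstein_variance.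
  rewrite subrr expr0n addr0 {2}(splitr e) lerD2l.
  move: X01; set z := X.[x] => /andP[z0 z1].
  have -> : C * ((b - a) / n%:R) ^+ 2 * (n%:R * (z * (1 - z))) =
     (C * (b - a) ^+ 2 / n%:R) * (z * (1 - z)) by field; rewrite gt_eqF.
  have h1 : C * (b - a) ^+ 2 / n%:R <= e / 2 by rewrite ler_pdivrMr// [leRHS]mulrC.
  have h2 : z * (1 - z) <= 1 by nra.
  apply: le_trans h1; rewrite ler_piMr// divr_ge0// mulr_ge0// sqr_ge0//.
have vk k : (k <= n)%N -> `|g k - f x| <= e / 2 + v k.
  move=> kn.
  have -> : v k = C * (a + (b - a) * (k%:R / n%:R) - x) ^+ 2.
    by rewrite /v Xx; field; rewrite !gt_eqF.
  apply: (fC _ _ _ xab); rewrite in_itv/=.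
  have k0 : 0 <= k%:R / n%:R :> R by rewrite divr_ge0.
  have k1 : k%:R / n%:R <= 1 :> R by rewrite ler_pdivrMr// mul1r ler_nat.
  by apply/andP; split; nra.
rewrite ler_norml; apply/andP; split.
- rewrite lerBrDr addrC.
  apply: (@le_trans _ _ ((bernstein X n (fun k => f x + - 1 * (e / 2 + v k))).[x])).
    by rewrite bernsteinD bernstein_cst bernsteinZ hornerD hornerC hornerZ mulN1r lerD2l lerN2.
  apply: bernstein_le => // k /vk; rewrite ler_norml => /andP[+ _]; lra.
- rewrite lerBlDr.
  apply: (@le_trans _ _ ((bernstein X n (fun k => f x + (e / 2 + v k))).[x])).
    apply: bernstein_le => // k /vk; rewrite ler_norml => /andP[_ +]; lra.
  by rewrite bernsteinD bernstein_cst hornerD hornerC addrC lerD2r.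
Qed.

End Weierstrass.

(** * Real inner product, norm and quadratic form *)

Section RealInner.
Context {R : realType} {H : hilbertType R}.
Implicit Types (x y z v : H) (T S : bop H) (t : R) (c : R[i]).

(** The inner product of the underlying real space; it is symmetric and bilinear over R. *)
Definition rin x y : R := complex.Re (inner x y).
(** The norm as an element of R: the norm of a module over R[i] takes its values in
   R[i]. *)
Definition hn x : R := complex.Re `|x|.

Lemma ReD (z w : R[i]) : complex.Re (z + w) = complex.Re z + complex.Re w.
Proof. by case: z w => [? ?] [? ?]. Qed.
Lemma ReN (z : R[i]) : complex.Re (- z) = - complex.Re z.
Proof. by case: z. Qed.
Lemma ReZ t (z : R[i]) : complex.Re (t%:C * z) = t * complex.Re z.
Proof. by case: z => a b /=; rewrite mul0r subr0. Qed.
Lemma innerC x y : inner x y = Num.conj (inner y x).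
Proof. by rewrite hermC expr0 mul1r. Qed.

Lemma innerDl x y z :
  inner (x + y) z = inner x z + inner y z.
Proof. by rewrite linearDl. Qed.
Lemma innerBl x y z :
  inner (x - y) z = inner x z - inner y z.
Proof. by rewrite linearBl. Qed.
Lemma innerDr x y z :
  inner x (y + z) = inner x y + inner x z.
Proof. by rewrite linearDr. Qed.
Lemma innerZl c x y :
  inner (c *: x) y = c * inner x y.
Proof. by rewrite linearZl_LR. Qed.
Lemma inner_realZr t x y :
  inner x (t%:C *: y) = t%:C * inner x y.
Proof.
rewrite linearZr_LR/=; congr (_ * _).
by apply: conj_Creal; rewrite complex_real.
Qed.

Lemma inner_suml I (r : seq I) (P : pred I) (F : I -> H) y :
  inner (\sum_(i <- r | P i) F i) y = \sum_(i <- r | P i) inner (F i) y.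
Proof.
by apply: (big_morph (fun x => inner x y)) => [x z|]; rewrite ?linearDl ?linear0l.
Qed.

Lemma inner_sumr I (r : seq I) (P : pred I) (F : I -> H) y :
  inner y (\sum_(i <- r | P i) F i) = \sum_(i <- r | P i) inner y (F i).
Proof.
by apply: (big_morph (fun x => inner y x)) => [x z|]; rewrite ?linearDr ?linear0r.
Qed.
Lemma rinC x y : rin x y = rin y x.
Proof. by rewrite /rin innerC; case: (inner y x). Qed.
Lemma rinDl x y z : rin (x + y) z = rin x z + rin y z.
Proof. by rewrite /rin linearDl/= ReD. Qed.
Lemma rinNl x z : rin (- x) z = - rin x z.
Proof. by rewrite /rin linearNl/= ReN. Qed.
Lemma rinZl t x z : rin (t%:C *: x) z = t * rin x z.
Proof. by rewrite /rin linearZl_LR/= ReZ. Qed.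
Lemma rinDr x y z : rin x (y + z) = rin x y + rin x z.
Proof. by rewrite rinC rinDl !(rinC x). Qed.
Lemma rinNr x z : rin x (- z) = - rin x z.
Proof. by rewrite rinC rinNl rinC. Qed.
Lemma rinZr t x z : rin x (t%:C *: z) = t * rin x z.
Proof. by rewrite rinC rinZl rinC. Qed.
Lemma rin0l x : rin 0 x = 0.
Proof. by rewrite /rin linear0l. Qed.
Lemma rin0r x : rin x 0 = 0.
Proof. by rewrite rinC rin0l. Qed.

Lemma normE x : `|x| = (hn x)%:C.
Proof.
have : 0 <= `|x| by [].
rewrite /hn lecE /= => /andP[/eqP h _].
by apply/eqP; rewrite eq_complex/= h !eqxx.
Qed.

Lemma hn_ge0 x : 0 <= hn x.
Proof. by rewrite -ler0c -normE. Qed.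
Lemma hn0 : hn 0 = 0.
Proof. by rewrite /hn normr0. Qed.
Lemma hnN x : hn (- x) = hn x.
Proof. by rewrite /hn normrN. Qed.
Lemma hnD x y : hn (x + y) <= hn x + hn y.
Proof. by rewrite -lecR rmorphD/= -!normE ler_normD. Qed.
Lemma hnB x y : hn (x - y) <= hn x + hn y.
Proof. by rewrite (le_trans (hnD _ _))// hnN. Qed.
Lemma hnBC x y : hn (x - y) = hn (y - x).
Proof. by rewrite -hnN opprB. Qed.
Lemma hnZ t x : hn (t%:C *: x) = `|t| * hn x.
Proof.
apply: complexI; rewrite -normE normrZ normE rmorphM; congr (_ * _).
by rewrite normc_def/= expr0n addr0 sqrtr_sqr.
Qed.
Lemma hn_eq0 x : hn x = 0 -> x = 0.
Proof. by move=> h; apply/eqP; rewrite -normr_eq0 normE h. Qed.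
Lemma hn_gt0 x : x != 0 -> 0 < hn x.
Proof.
by move=> x0; rewrite lt_def hn_ge0 andbT; apply: contra x0 => /eqP/hn_eq0->.
Qed.

Lemma hn_sum I (r : seq I) (F : I -> H) :
  hn (\sum_(i <- r) F i) <= \sum_(i <- r) hn (F i).
Proof.
elim: r => [|i r IH]; first by rewrite !big_nil hn0.
by rewrite !big_cons (le_trans (hnD _ _))// lerD2l.
Qed.

Lemma hn_scale (c : R[i]) x :
  hn (c *: x) = complex.Re `|c| * hn x.
Proof.
apply: complexI; rewrite -normE normrZ normE rmorphM; congr (_ * _).
Qed.

Lemma inner_hn x : inner x x = (hn x ^+ 2)%:C.
Proof. by rewrite -inner_norm normE rmorphXn. Qed.
Lemma rinE x : rin x x = hn x ^+ 2.
Proof. by rewrite /rin inner_hn. Qed.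
Lemma hn2D x y : hn (x + y) ^+ 2 = hn x ^+ 2 + 2 * rin x y + hn y ^+ 2.
Proof. by rewrite -!rinE rinDl !rinDr (rinC y x); ring. Qed.
Lemma hn2B x y : hn (x - y) ^+ 2 = hn x ^+ 2 - 2 * rin x y + hn y ^+ 2.
Proof. by rewrite hn2D rinNr hnN; ring. Qed.

Lemma hn2D_le x y : hn (x + y) ^+ 2 <= 2 * hn x ^+ 2 + 2 * hn y ^+ 2.
Proof. by have := sqr_ge0 (hn (x - y)); rewrite hn2B hn2D; lra. Qed.
Lemma hn2Z t x : hn (t%:C *: x) ^+ 2 = t ^+ 2 * hn x ^+ 2.
Proof. by rewrite hnZ exprMn real_normK ?num_real. Qed.

(** Norm bounds in squared form, so that they can be expanded as quadratic forms. *)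
Lemma hn_le2 (M : R) x y : 0 <= M ->
  (hn x <= M * hn y) = (hn x ^+ 2 <= M ^+ 2 * hn y ^+ 2).
Proof.
by move=> M0; rewrite -exprMn ler_sqr// nnegrE ?hn_ge0// mulr_ge0// hn_ge0.
Qed.

Lemma rin_le x y : rin x y <= hn x * hn y.
Proof.
have [->|x0] := eqVneq x 0; first by rewrite rin0l hn0 mul0r.
have hx := hn_gt0 x0.
have [->|y0] := eqVneq y 0; first by rewrite rin0r hn0 mulr0.
have hy := hn_gt0 y0.
have := sqr_ge0 (hn ((hn y)%:C *: x - (hn x)%:C *: y)).
rewrite hn2B !hn2Z rinZl rinZr.
move=> h; rewrite -(ler_pM2l (mulr_gt0 hx hy)); nra.
Qed.

Lemma normr_rin_le x y : `|rin x y| <= hn x * hn y.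
Proof. by rewrite ler_norml rin_le andbT lerNl -rinNl -(hnN x) rin_le. Qed.

(** The complex form of the Cauchy-Schwarz inequality, obtained from [rin_le] by
   rotating x so that the inner product becomes nonnegative. *)
Lemma cauchy_schwarz x y :
  complex.Re `|inner x y| <= hn x * hn y.
Proof.
set z := inner x y; set r := complex.Re `|z|.
have rE : r%:C = `|z| by rewrite RRe_real// normr_real.
have [z0|z0] := eqVneq z 0.
  by rewrite /r z0 normr0 mulr_ge0// hn_ge0.
have r0 : 0 < r by rewrite -ltcR rE normr_gt0.
have := rin_le (Num.conj z *: x) y.
rewrite /rin linearZl_LR/= -/z mulrC -normCK -rE -rmorphXn/=.
rewrite hn_scale norm_conjC -/r -mulrA expr2.
by rewrite ler_pM2l.
Qed.

Lemma bop_boundE T : exists2 M : R, 0 <= M & forall x, hn (T x) <= M * hn x.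
Proof.
have [M M0 TM] := bop_bounded_pos T; exists M => // x.
by have := TM x; rewrite !normE -rmorphM lecR.
Qed.

(** The operator norm of T is at most M. *)
Definition opnorm_le T (M : R) := forall x, hn (T x) <= M * hn x.

Lemma opnorm_leP T (M : R) : (forall x, `|T x| <= M%:C * `|x|) <-> opnorm_le T M.
Proof.
by split=> h x; have := h x; rewrite !normE -rmorphM lecR.
Qed.

Lemma bopDE S T x : (S + T) x = S x + T x. Proof. by []. Qed.
Lemma bopNE T x : (- T) x = - T x. Proof. by []. Qed.
Lemma bopBE S T x : (S - T) x = S x - T x. Proof. by []. Qed.
Lemma bopZE c T x : (c *: T) x = c *: T x. Proof. by []. Qed.
Lemma bopME S T x : (S * T) x = S (T x). Proof. by []. Qed.
Lemma bop1E x : (1 : bop H) x = x. Proof. by []. Qed.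
Lemma bop0E x : (0 : bop H) x = 0. Proof. by []. Qed.
Definition bopE := (bopDE, bopNE, bopZE, bopME, bop1E, bop0E).
Lemma bop_sumE I (r : seq I) (P : pred I) (F : I -> bop H) x :
  (\sum_(i <- r | P i) F i) x = \sum_(i <- r | P i) F i x.
Proof. by rewrite (big_morph (fun T : bop H => T x) (fun S T => bopDE S T x) (bop0E x)). Qed.

Lemma qformE T v : qform T v = rin (T v) v. Proof. by []. Qed.
Lemma qformD S T v : qform (S + T) v = qform S v + qform T v.
Proof. by rewrite !qformE bopE rinDl. Qed.
Lemma qformB S T v : qform (S - T) v = qform S v - qform T v.
Proof. by rewrite /qform bopE linearBl/= ReD ReN. Qed.
Lemma qformN T v : qform (- T) v = - qform T v.
Proof. by rewrite qformE bopE rinNl. Qed.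
Lemma qformZ t T v : qform (t%:C *: T) v = t * qform T v.
Proof. by rewrite !qformE bopE rinZl. Qed.
Lemma qformZ1 t v : qform (t%:C *: (1 : bop H)) v = t * hn v ^+ 2.
Proof. by rewrite qformE !bopE rinZl rinE. Qed.

Lemma selfadjoint_inner_real T v : selfadjoint T -> inner (T v) v = (qform T v)%:C.
Proof.
move=> sT; have := innerC (T v) v; rewrite -sT /qform.
by case: (inner _ _) => a b [] /= hb; apply/eqP; rewrite eq_complex/= eqxx/=; lra.
Qed.

Lemma selfadjoint_rin T x y : selfadjoint T -> rin (T x) y = rin x (T y).
Proof. by move=> sT; rewrite /rin sT. Qed.

Lemma selfadjointD S T : selfadjoint S -> selfadjoint T -> selfadjoint (S + T).
Proof. by move=> sS sT x y; rewrite !bopE linearDl linearDr/= sS sT. Qed.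
Lemma selfadjointZ t T : selfadjoint T -> selfadjoint (t%:C *: T).
Proof.
move=> sT x y; rewrite !bopE linearZl_LR linearZr_LR/= sT; congr (_ * _).
by symmetry; apply: conj_Creal; rewrite complex_real.
Qed.
Lemma selfadjoint1 : selfadjoint (1 : bop H). Proof. by []. Qed.
Lemma selfadjoint0 : selfadjoint (0 : bop H).
Proof. by move=> x y; rewrite !bopE linear0l linear0r. Qed.
Lemma selfadjointN T : selfadjoint T -> selfadjoint (- T).
Proof. by move=> sT x y; rewrite !bopE linearNl linearNr/= sT. Qed.
Lemma selfadjointX T n : selfadjoint T -> selfadjoint (T ^+ n).
Proof.
move=> sT; elim: n => // n IH x y.
by rewrite {1}exprS bopE sT IH exprSr bopE.
Qed.
Lemma selfadjoint_sum I (r : seq I) (P : pred I) (F : I -> bop H) :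
  (forall i, selfadjoint (F i)) -> selfadjoint (\sum_(i <- r | P i) F i).
Proof.
move=> sF; apply: (big_ind (@selfadjoint _ _)) => // [|S T];
  [exact: selfadjoint0 | exact: selfadjointD].
Qed.

(** The numerical range of T lies in [a, b], that is a <= T <= b in the operator
   order when T is self-adjoint. *)
Definition numrange (a b : R) T := forall v,
  a * hn v ^+ 2 <= qform T v <= b * hn v ^+ 2.

(** If - e <= T <= e then the norm of T is at most e. For M > e the operators M - T
   and M + T are positive, hence so is
   (M - T)(M + T)(M - T) + (M + T)(M - T)(M + T) = 2 M (M^2 - T^2). *)
Lemma numrange_norm T (e : R) : 0 <= e -> selfadjoint T -> numrange (- e) e T ->
  opnorm_le T e.
Proof.
move=> e0 sT nT.
(* M > 0 is needed to divide by it, so e is approached from above when it is 0. *)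
suff key (M : R) : 0 < M -> e <= M -> opnorm_le T M.
  move=> x; apply/ler_addgt0Pr => d d0.
  have [->|x0] := eqVneq x 0.
    by rewrite linear0 hn0 mulr0 add0r ltW.
  have hx := hn_gt0 x0.
  have p1 : 0 < e + d / hn x by rewrite ltr_wpDl// divr_gt0.
  have p2 : e <= e + d / hn x by rewrite lerDl divr_ge0// ltW.
  have h := key _ p1 p2 x.
  by rewrite (le_trans h)// mulrDl divfK// gt_eqF.
move=> M0 eM x.
rewrite hn_le2 ?(ltW M0)//.
have pos1 y : 0 <= M * hn y ^+ 2 - rin (T y) y.
  rewrite subr_ge0 -qformE; have /andP[_ /le_trans] := nT y; apply.
  by rewrite ler_wpM2r ?sqr_ge0.
have pos2 y : 0 <= M * hn y ^+ 2 + rin (T y) y.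
  have /andP[h _] := nT y; rewrite -qformE.
  have : e * hn y ^+ 2 <= M * hn y ^+ 2 by rewrite ler_wpM2r ?sqr_ge0.
  lra.
have := pos2 (M%:C *: x - T x); have := pos1 (M%:C *: x + T x).
rewrite linearB linearD linearZ/= hn2B hn2D !rinDr !rinDl !rinNr !rinNl.
rewrite !rinZl !rinZr !hn2Z (selfadjoint_rin (T x) x sT) !rinE (rinC x (T x)).
move=> h1 h2; rewrite -(ler_pM2l M0); nra.
Qed.

(** The Cauchy-Schwarz inequality of a positive operator against its own values; it is
   read off from the positivity of T at v - T v / M. *)
Lemma positive_norm T (M : R) : 0 < M -> selfadjoint T -> opnorm_le T M ->
  (forall v, 0 <= qform T v) -> forall v, hn (T v) ^+ 2 <= M * qform T v.
Proof.
move=> M0 sT TM Tpos v; set t := M^-1.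
have t0 : 0 < t by rewrite invr_gt0.
have := Tpos (v - t%:C *: T v).
rewrite qformE linearB linearZ/= rinDl !rinDr !rinNl !rinNr !rinZl !rinZr.
have h1 : rin (T (T v)) v = hn (T v) ^+ 2 by rewrite selfadjoint_rin// rinE.
have h2 : rin (T v) (T v) = hn (T v) ^+ 2 by rewrite rinE.
have h3 : rin (T (T v)) (T v) <= M * hn (T v) ^+ 2.
  rewrite (le_trans (rin_le _ _))// expr2 mulrA ler_wpM2r ?hn_ge0//; exact: TM.
have tM : t * M = 1 by rewrite mulVf// gt_eqF.
have h4 : t * (t * rin (T (T v)) (T v)) <= t * hn (T v) ^+ 2.
  rewrite ler_pM2l// -[leRHS]mul1r -tM -mulrA ler_pM2l//.
rewrite h1 h2 -qformE => h5.
rewrite -(ler_pM2l t0) [leRHS]mulrA tM mul1r; lra.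
Qed.

Lemma opnorm_numrange T (M : R) : opnorm_le T M -> numrange (- M) M T.
Proof.
move=> TM v; rewrite mulNr -ler_norml qformE (le_trans (normr_rin_le _ _))//.
by rewrite expr2 mulrA ler_wpM2r ?hn_ge0//; exact: TM.
Qed.

End RealInner.

(** * Invertible operators and the spectrum of a self-adjoint operator *)

Section Invertibility.
Context {R : realType} {H : hilbertType R}.
Implicit Types (x y z v : H) (A B S T : bop H) (t : R) (c : R[i]).

Lemma opnorm_leD S T (M N : R) :
  opnorm_le S M -> opnorm_le T N -> opnorm_le (S + T) (M + N).
Proof.
by move=> SM TN x; rewrite bopE (le_trans (hnD _ _))// mulrDl lerD.
Qed.

Lemma opnorm_leN T (M : R) : opnorm_le T M -> opnorm_le (- T) M.
Proof. by move=> TM x; rewrite bopE hnN. Qed.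

Lemma opnorm_leM S T (M N : R) : 0 <= M ->
  opnorm_le S M -> opnorm_le T N -> opnorm_le (S * T) (M * N).
Proof.
move=> M0 SM TN x; rewrite bopE (le_trans (SM _))// -mulrA ler_wpM2l//.
Qed.

Lemma opnorm_leW T (M N : R) : M <= N -> opnorm_le T M -> opnorm_le T N.
Proof.
by move=> MN TM x; rewrite (le_trans (TM x))// ler_wpM2r ?hn_ge0.
Qed.

Lemma opnorm_le1 : opnorm_le (1 : bop H) 1.
Proof. by move=> x; rewrite bopE mul1r. Qed.

Lemma opnorm_le0 (M : R) : 0 <= M -> opnorm_le (0 : bop H) M.
Proof. by move=> M0 x; rewrite bopE hn0 mulr_ge0// hn_ge0. Qed.

Lemma opnorm_eq0 T : (forall e, 0 < e -> opnorm_le T e) -> T = 0.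
Proof.
move=> Te; apply: bop_ext => x; apply/eqP/negPn/negP => Tx0.
have x0 : x != 0 by apply: contra Tx0 => /eqP->; rewrite linear0.
have hx := hn_gt0 x0; have hT := hn_gt0 Tx0.
have e0 : 0 < hn (T x) / (2 * hn x) by rewrite divr_gt0// mulr_gt0.
have := Te _ e0 x.
have -> : hn (T x) / (2 * hn x) * hn x = hn (T x) / 2 by field; rewrite gt_eqF.
lra.
Qed.

Lemma cauchy_hn_cvg (u : nat -> H) :
  (forall e, 0 < e -> exists N, forall n, (N <= n)%N -> hn (u N - u n) < e) ->
  cvgn u.
Proof.
move=> uc; apply/cauchy_cvgP/cauchy_exP => -[e1 e2].
rewrite ltcE/= => /andP[/eqP -> e0]; have [N NP] := uc _ e0.
exists (u N), N => // n /= /NP; rewrite -ball_normE/= normE.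
by rewrite complexr0 ltcR.
Qed.

(** B(H) is complete for the operator norm. *)
Lemma bop_complete (T_ : nat -> bop H) :
  (forall e, 0 < e -> exists N, forall n, (N <= n)%N -> opnorm_le (T_ N - T_ n) e) ->
  exists T, forall e, 0 < e -> exists N, forall n, (N <= n)%N -> opnorm_le (T_ n - T) e.
Proof.
move=> Tc.
have cx x : T_ n x @[n --> \oo] --> limn (fun n => T_ n x).
  apply: cauchy_hn_cvg => e e0.
  have hx : 0 < hn x + 1 by rewrite ltr_wpDl// hn_ge0.
  have [N NP] := Tc _ (divr_gt0 e0 hx); exists N => n /NP /(_ x).
  rewrite bopE => /le_lt_trans; apply.
  by rewrite mulrAC ltr_pdivrMr// ltr_pM2l// ltrDl.
set L := fun x => limn (fun n => T_ n x) in cx.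
have lL : linear L.
  move=> a x y; apply: cvg_lim => //.
  under eq_fun do rewrite linearP.
  by apply: cvgD; [apply: cvgZl_tmp|]; exact: cx.
have near_lim x (d : R) N : 0 < d -> exists2 n, (N <= n)%N & hn (L x - T_ n x) <= d.
  move=> d0; have d0' : 0 < (d%:C : R[i]) by rewrite ltcR.
  move/cvgrPdist_le : (cx x) => /(_ _ d0') [n0 _ n0P].
  exists (maxn N n0); first exact: leq_maxl.
  by have := n0P (maxn N n0) (leq_maxr _ _); rewrite normE lecR.
have key e N : 0 < e -> (forall n, (N <= n)%N -> opnorm_le (T_ N - T_ n) e) ->
    forall n, (N <= n)%N -> forall x, hn (T_ n x - L x) <= (2 * e) * hn x.
  move=> e0 NP n Nn x; apply/ler_addgt0Pr => d d0.
  have [m Nm md] := near_lim x d N d0.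
  have -> : T_ n x - L x = (T_ N x - T_ m x) - (T_ N x - T_ n x) - (L x - T_ m x).
    by rewrite !opprB (addrC (T_ N x - _)) !subrKA.
  rewrite (le_trans (hnB _ _))// lerD// (le_trans (hnB _ _))//.
  by rewrite -mulrA mulr_natl mulr2n; apply: lerD; exact: NP.
have [N NP] := Tc 1 ltr01.
have [M M0 NM] := bop_boundE (T_ N).
have bL : exists M : R, forall x, `|L x| <= M%:C * `|x|.
  exists (M + 2) => x; rewrite !normE -rmorphM lecR.
  have -> : L x = T_ N x - (T_ N x - L x) by rewrite subKr.
  rewrite (le_trans (hnB _ _))// mulrDl lerD//.
  by have := key 1 N ltr01 NP N (leqnn N) x; rewrite mulr1.
exists (Bop lL bL) => e e0; have e2 : 0 < e / 2 by rewrite divr_gt0.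
have [K KP] := Tc _ e2.
exists K => n Kn x; rewrite bopE/=.
by have := key _ _ e2 KP n Kn x; rewrite (mulrC 2) divfK.
Qed.

(** Invertibility in B(H), the condition negated in the definition of the spectrum. *)
Definition invertible A := exists S, S * A = 1 /\ A * S = 1.

Lemma invertible1 : invertible (1 : bop H).
Proof. by exists 1; rewrite mul1r. Qed.

Lemma invertibleM A B : invertible A -> invertible B -> invertible (A * B).
Proof.
move=> [S [SA AS]] [T [TB BT]]; exists (T * S); split.
- by rewrite mulrA -(mulrA T) SA mulr1 TB.
- by rewrite mulrA -(mulrA A) BT mulr1 AS.
Qed.

Lemma bopZAl c A B : (c *: A) * B = c *: (A * B).
Proof. exact: bop_ext. Qed.
Lemma bopZAr c A B : A * (c *: B) = c *: (A * B).
Proof. by apply: bop_ext => x; rewrite !bopE linearZ. Qed.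

Lemma invertibleZ c A : c != 0 -> invertible (c *: A) <-> invertible A.
Proof.
move=> c0; split=> -[S [SA AS]].
- by exists (c *: S); rewrite bopZAr in SA; rewrite bopZAl in AS; rewrite bopZAl bopZAr.
- exists (c^-1 *: S); rewrite !bopZAl !bopZAr SA AS !scalerA.
  by rewrite mulVf// divff// !scale1r.
Qed.

(** 1 - B is invertible when B has norm less than 1. The partial sums P_n of the
   Neumann series are given by P_{n+1} = 1 + B P_n; their limit T satisfies
   T = 1 + B T and commutes with B. *)
Lemma neumann_invertible B (q : R) : 0 <= q < 1 -> opnorm_le B q -> invertible (1 - B).
Proof.
move=> /andP[q0 q1] Bq.
pose P := fix P n : bop H := if n is m.+1 then 1 + B * P m else 0.
have PC n : B * P n = P n * B.
  elim: n => [|n IH] /=; first by rewrite mulr0 mul0r.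
  by rewrite mulrDr mulrDl mulr1 mul1r [in LHS]IH mulrA.
have q1' : 0 < 1 - q by rewrite subr_gt0.
have q2 : 0 <= (1 - q)^-1 by rewrite invr_ge0 ltW.
have Pb n : opnorm_le (P n) (1 - q)^-1.
  elim: n => [|n IH] /=; first exact: opnorm_le0.
  have -> : (1 - q)^-1 = 1 + q * (1 - q)^-1 by field; rewrite gt_eqF.
  by apply: opnorm_leD; [exact: opnorm_le1 | exact: opnorm_leM].
have Pd n p : opnorm_le (P n - P (n + p)%N) (q ^+ n * (1 - q)^-1).
  elim: n => [|n IH] /=.
    by rewrite sub0r expr0 mul1r; apply: opnorm_leN.
  have -> : 1 + B * P n - (1 + B * P (n + p)%N) = B * (P n - P (n + p)%N).
    by rewrite mulrBr opprD addrACA subrr add0r.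
  by rewrite exprS -mulrA; apply: opnorm_leM.
have [T TP] : exists T, forall e, 0 < e ->
    exists N, forall n, (N <= n)%N -> opnorm_le (P n - T) e.
  apply: bop_complete => e e0.
  have : (GRing.exp q : R^nat) @ \oo --> (0 : R).
    by apply: cvg_expr; rewrite ger0_norm.
  move/cvgrPdist_le => /(_ (e * (1 - q))); rewrite mulr_gt0// => /(_ isT) [N _ NP].
  exists N => n Nn; rewrite -(subnKC Nn); apply: opnorm_leW (Pd _ _).
  rewrite ler_pdivrMr//; have := NP N (leqnn N).
  by rewrite sub0r normrN ger0_norm// exprn_ge0.
have fix1 : T - (1 + B * T) = 0.
  apply: opnorm_eq0 => e e0; have e2 : 0 < e / 2 by rewrite divr_gt0.
  have [N NP] := TP _ e2.
  have -> : T - (1 + B * T) = B * (P N - T) - (P N.+1 - T).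
    rewrite /= mulrBr opprB [RHS]addrC opprD addrA.
    by rewrite [in RHS]opprD [in RHS](addrA T) subrKA.
  have -> : e = 1 * (e / 2) + e / 2 by field.
  apply: opnorm_leD; last by apply/opnorm_leN/NP.
  apply: opnorm_leM => //; last exact: NP.
  exact: opnorm_leW (ltW q1) Bq.
have TB : B * T = T * B.
  apply/eqP; rewrite -subr_eq0; apply/eqP; apply: opnorm_eq0 => e e0.
  have e2 : 0 < e / 2 by rewrite divr_gt0.
  have [N NP] := TP _ e2.
  have -> : B * T - T * B = (P N - T) * B - B * (P N - T).
    by rewrite mulrBr mulrBl PC opprB [RHS]addrC subrKA.
  have -> : e = e / 2 * 1 + 1 * (e / 2) by field.
  have B1 := opnorm_leW (ltW q1) Bq.
  apply: opnorm_leD.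
    by apply: opnorm_leM => //; [exact: ltW | exact: NP].
  by apply: opnorm_leN; apply: opnorm_leM => //; exact: NP.
move/eqP: fix1; rewrite subr_eq0 => /eqP fix1.
exists T; split.
- by rewrite mulrBr mulr1 -TB {1}fix1 addrK.
- by rewrite mulrBl mul1r {1}fix1 addrK.
Qed.

(** An operator whose real quadratic form is at least c |v|^2, c > 0, is invertible:
   1 - t A is a contraction for a small t > 0. *)
Lemma coercive_invertible A (c : R) : 0 < c ->
  (forall v, c * hn v ^+ 2 <= rin (A v) v) -> invertible A.
Proof.
move=> c0 Ac; have [M M0 AM] := bop_boundE A.
(* t minimizes 1 - 2 t c + t^2 K, which bounds the square of the norm of 1 - t A;
   K rather than M^2 keeps the minimum k nonnegative. *)
pose K := M ^+ 2 + c ^+ 2.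
have K0 : 0 < K by rewrite ltr_wpDl ?sqr_ge0// exprn_gt0.
pose t := c / K; have t0 : 0 < t by rewrite divr_gt0.
pose k := 1 - c ^+ 2 / K.
have k0 : 0 <= k.
  by rewrite subr_ge0 ler_pdivrMr// mul1r lerDr sqr_ge0.
have k1 : k < 1 by rewrite ltrBlDr ltrDl divr_gt0// exprn_gt0.
have inv : invertible (1 - (1 - t%:C *: A)).
  apply: (@neumann_invertible _ (Num.sqrt k)).
    rewrite sqrtr_ge0/= -[ltRHS]sqrtr1 ltr_sqrt//.
  move=> v; rewrite hn_le2 ?sqrtr_ge0// sqr_sqrtr// !bopE.
  rewrite hn2B hn2Z rinZr.
  have := Ac v; rewrite rinC => Av.
  have AMv : hn (A v) ^+ 2 <= M ^+ 2 * hn v ^+ 2 by rewrite -hn_le2.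
  have h1 : t * (c * hn v ^+ 2) <= t * rin v (A v) by rewrite ler_pM2l.
  have h2 : t ^+ 2 * hn (A v) ^+ 2 <= t ^+ 2 * (K * hn v ^+ 2).
    rewrite ler_pM2l ?exprn_gt0//; apply: le_trans AMv _.
    by rewrite ler_wpM2r ?sqr_ge0// lerDl sqr_ge0.
  have h3 : k * hn v ^+ 2 =
      hn v ^+ 2 - 2 * (t * (c * hn v ^+ 2)) + t ^+ 2 * (K * hn v ^+ 2).
    by rewrite /k /t; field; rewrite gt_eqF.
  by rewrite h3; lra.
move: inv; rewrite opprB addrCA subrr addr0 => /invertibleZ; apply.
by rewrite eq_complex/= eqxx andbT gt_eqF.
Qed.

Lemma coercive_rotation_invertible A k (c : R) : k != 0 -> 0 < c ->
  (forall v, c * hn v ^+ 2 <= complex.Re (k * inner (A v) v)) -> invertible A.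
Proof.
move=> k0 c0 Ac; apply/(invertibleZ _ k0)/(coercive_invertible c0) => v.
by rewrite /rin bopE linearZl_LR.
Qed.

Lemma spectrumP T (lam : R[i]) :
  spectrum T lam <-> ~ invertible (lam *: (1 : bop H) - T).
Proof. by []. Qed.

Lemma numrange_spectrum (a b : R) T : selfadjoint T -> numrange a b T ->
  spectrum T `<=` real_set `[a, b].
Proof.
move=> sT nT [l1 l2] /spectrumP sl.
have innerE v : inner (((l1 +i* l2) *: (1 : bop H) - T) v) v =
    (l1 * hn v ^+ 2 - qform T v) +i* (l2 * hn v ^+ 2).
  rewrite !bopE linearBl/= linearZl_LR/= inner_hn selfadjoint_inner_real//.
  by apply/eqP; rewrite eq_complex/=; apply/andP; split; apply/eqP; ring.
(* Multiplied by - i l2, the form of lam - T has real part l2^2 |v|^2. *)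
have l20 : l2 = 0.
  apply/eqP/negPn/negP => l20; apply: sl.
  apply: (@coercive_rotation_invertible _ (0 -i* l2) (l2 ^+ 2)).
  - by rewrite eq_complex/= oppr_eq0 (negbTE l20) andbF.
  - by rewrite lt_def sqr_ge0 sqrf_eq0 l20.
  - by move=> v; rewrite innerE/= -subr_ge0 le_eqVlt; apply/orP; left; apply/eqP; ring.
subst l2; exists l1 => //=; rewrite in_itv/=; apply/andP; split.
- rewrite leNgt; apply/negP => la; apply: sl.
  apply: (@coercive_rotation_invertible _ (- 1)%:C (a - l1)).
  + by rewrite eq_complex/= oppr_eq0 oner_eq0.
  + by rewrite subr_gt0.
  + by move=> v; rewrite innerE/=; have /andP[] := nT v; lra.
- rewrite leNgt; apply/negP => la; apply: sl.
  apply: (@coercive_rotation_invertible _ 1%:C (l1 - b)).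
  + by rewrite eq_complex/= oner_eq0.
  + by rewrite subr_gt0.
  + by move=> v; rewrite innerE/=; have /andP[] := nT v; lra.
Qed.

(** The infimum m of the quadratic form on the unit sphere belongs to the spectrum:
   T - m is positive and [positive_norm] makes it small along a minimizing sequence
   of unit vectors, so that it is not bounded below. The vector v0 states that H is
   not 0. *)
Lemma numrange_inf_spectrum T v0 : selfadjoint T -> v0 != 0 ->
  exists2 m, spectrum T m%:C & forall v, m * hn v ^+ 2 <= qform T v.
Proof.
move=> sT v00; have [M M0 TM] := bop_boundE T.
pose E := [set qform T v | v in [set v | hn v = 1]].
have E0 : E !=set0.
  exists (qform T ((hn v0)^-1%:C *: v0)); eexists; last reflexivity.
  by rewrite /= hnZ ger0_norm ?invr_ge0 ?hn_ge0// mulVf// gt_eqF// hn_gt0.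
have Elb : has_lbound E.
  exists (- M) => _ [v /= v1 <-].
  by have /andP[+ _] := opnorm_numrange TM v; rewrite v1 expr1n mulr1.
pose m := inf E.
have infE : has_inf E by split.
have mT v : m * hn v ^+ 2 <= qform T v.
  have [->|/hn_gt0 hv] := eqVneq v 0.
    by rewrite hn0 expr0n mulr0 qformE linear0 rin0l.
  have : E (qform T ((hn v)^-1%:C *: v)).
    eexists; last reflexivity.
    by rewrite /= hnZ ger0_norm ?invr_ge0 ?hn_ge0// mulVf// gt_eqF.
  move=> /(ge_inf Elb); rewrite -/m qformE linearZ/= rinZl rinZr -qformE.
  rewrite mulrA -expr2 exprVn => h.
  by rewrite -ler_pdivlMr ?exprn_gt0// mulrC.
exists m => //; apply/spectrumP => -[S [Sm _]].
have [K0 K00 SK0] := bop_boundE S.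
pose K := K0 + 1; have Kp : 0 < K by rewrite ltr_wpDl.
have SK x : hn (S x) <= K * hn x.
  by apply: (opnorm_leW _ SK0); rewrite lerDl.
pose P := T - m%:C *: (1 : bop H).
have sP : selfadjoint P.
  by apply: selfadjointD => //; apply/selfadjointN/selfadjointZ/selfadjoint1.
have Ppos v : 0 <= qform P v by rewrite qformB qformZ1 subr_ge0.
have [L0 L00 PL0] := bop_boundE P.
pose L := L0 + 1; have Lp : 0 < L by rewrite ltr_wpDl.
have PL : opnorm_le P L by apply: (opnorm_leW _ PL0); rewrite lerDl.
pose d := (K ^+ 2 * L)^-1.
have d0 : 0 < d by rewrite invr_gt0 mulr_gt0// exprn_gt0.
have lb : lbound E (m + d).
  move=> _ [v /= v1 <-].
  have h1 : 1 <= K ^+ 2 * hn (P v) ^+ 2.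
    rewrite -exprMn -(@expr1n R 2) ler_sqr ?nnegrE// ?mulr_ge0 ?hn_ge0 ?(ltW Kp)//.
    rewrite -v1 -{1}[v]bop1E -Sm -[hn (P v)]hnN.
    rewrite bopE (_ : - P v = (m%:C *: (1 : bop H) - T) v); first exact: SK.
    by rewrite /P !bopE opprB.
  have h2 := positive_norm Lp sP PL Ppos v.
  have h3 : 1 <= K ^+ 2 * L * (qform T v - m).
    apply: le_trans h1 _; rewrite -mulrA ler_pM2l ?exprn_gt0//.
    by move: h2; rewrite qformB qformZ1 v1 expr1n mulr1.
  rewrite -lerBrDl /d -div1r ler_pdivrMr ?mulr_gt0 ?exprn_gt0//.
  by rewrite mulrC.
have := lb_le_inf E0 lb; rewrite -/m; lra.
Qed.

Lemma spectrum_extremes T v0 : selfadjoint T -> v0 != 0 ->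
  exists a b : R, [/\ spectrum T a%:C, spectrum T b%:C & numrange a b T].
Proof.
move=> sT v00.
have [a sa aT] := numrange_inf_spectrum sT v00.
have [b sb bT] := numrange_inf_spectrum (selfadjointN sT) v00.
exists a, (- b); split => //; last first.
  by move=> v; rewrite aT/=; have := bT v; rewrite qformN; lra.
apply: contra_not sb => inv.
have -> : b%:C *: (1 : bop H) - - T = (-1) *: ((- b)%:C *: (1 : bop H) - T).
  by rewrite scaleN1r opprB opprK rmorphN scaleNr opprK addrC.
by apply/invertibleZ => //; rewrite oppr_eq0 oner_eq0.
Qed.

Lemma spectrum_numrange (a b : R) T : selfadjoint T ->
  spectrum T `<=` real_set `[a, b] -> numrange a b T.
Proof.
move=> sT sub v.
have [->|v0] := eqVneq v 0; first by rewrite hn0 expr0n !mulr0 qformE linear0 rin0l lexx.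
have [m [M [/sub[m' + [mm]] /sub[M' + [MM]] nT]]] := spectrum_extremes sT v0.
rewrite {}mm {}MM /= !in_itv/= => /andP[am _] /andP[_ Mb].
have /andP[h1 h2] := nT v; apply/andP; split.
- by apply: le_trans h1; rewrite ler_wpM2r ?sqr_ge0.
- by apply: (le_trans h2); rewrite ler_wpM2r ?sqr_ge0.
Qed.

End Invertibility.

(** * Polynomials of an operator and spectral mapping *)

Section PolynomialCalculus.
Context {R : realType} {H : hilbertType R}.
Implicit Types (x y z v : H) (A B S T h : bop H) (t : R) (c : R[i]).
Implicit Types (p : {poly R}) (q : {poly R[i]}).

(** Complex polynomials of an operator. *)
Definition cpoly q T : bop H := \sum_(k < size q) q`_k *: T ^+ k.

Lemma cpoly_widen n q T : (size q <= n)%N ->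
  cpoly q T = \sum_(k < n) q`_k *: T ^+ k.
Proof.
move=> qn; rewrite /cpoly (big_ord_widen n (fun k => q`_k *: T ^+ k))//.
rewrite big_mkcond/=; apply: eq_bigr => k _.
by case: ltnP => // /(nth_default 0) ->; rewrite scale0r.
Qed.

Lemma cpolyD q1 q2 T : cpoly (q1 + q2) T = cpoly q1 T + cpoly q2 T.
Proof.
pose n := maxn (size q1) (size q2).
rewrite !(@cpoly_widen n) ?leq_maxl ?leq_maxr ?(leq_trans (size_polyD _ _))//.
by rewrite -big_split/=; apply: eq_bigr => k _; rewrite coefD scalerDl.
Qed.

Lemma cpolyC c T : cpoly c%:P T = c *: (1 : bop H).
Proof.
rewrite (@cpoly_widen 1) ?size_polyC_leq1//.
by rewrite big_ord1 coefC expr0.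
Qed.

Lemma cpolyZ c q T : cpoly (c *: q) T = c *: cpoly q T.
Proof.
rewrite (@cpoly_widen (size q)) ?size_scale_leq// /cpoly scaler_sumr.
by apply: eq_bigr => k _; rewrite coefZ scalerA.
Qed.

Lemma cpolyN q T : cpoly (- q) T = - cpoly q T.
Proof. by rewrite -scaleN1r cpolyZ scaleN1r. Qed.

Lemma cpolyMX q T : cpoly (q * 'X) T = T * cpoly q T.
Proof.
rewrite (@cpoly_widen (size q).+1); last first.
  by rewrite (leq_trans (size_polyMleq _ _))// size_polyX addn2.
rewrite big_ord_recl/= coefMX/= scale0r add0r /cpoly mulr_sumr.
by apply: eq_bigr => k _; rewrite coefMX/= /bump/= add1n/= exprS bopZAr.
Qed.

Lemma cpolyM q1 q2 T : cpoly (q1 * q2) T = cpoly q1 T * cpoly q2 T.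
Proof.
elim/poly_ind: q1 => [|q1 c IH].
  by rewrite mul0r -polyC0 cpolyC scale0r mul0r.
rewrite mulrDl mulrAC !cpolyD !cpolyMX IH mul_polyC cpolyZ cpolyC mulrDl.
by rewrite mulrA bopZAl mul1r.
Qed.

Lemma cpolyX_sub c T : cpoly ('X - c%:P) T = T - c *: (1 : bop H).
Proof. by rewrite cpolyD cpolyN cpolyC -[X in cpoly X]mul1r cpolyMX -polyC1 cpolyC scale1r mulr1. Qed.

(** The inclusion of spectral mapping that is needed: q(T) is invertible if no root of
   q is in the spectrum of T. The polynomial q splits over R[i], and q(T) is a
   product of invertible factors. *)
Lemma cpoly_invertible q T : q != 0 ->
  (forall c, root q c -> invertible (c *: (1 : bop H) - T)) ->
  invertible (cpoly q T).
Proof.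
move=> q0 qT; have [r qr] := closed_field_poly_normal q.
have lq : lead_coef q != 0 by rewrite lead_coef_eq0.
have {}qT c : c \in r -> invertible (c *: (1 : bop H) - T).
  by move=> cr; apply: qT; rewrite qr rootZ// root_prod_XsubC.
rewrite qr cpolyZ; apply/(invertibleZ _ lq) => {qr}.
elim: r qT => [|c r IH] qT.
  by rewrite big_nil -polyC1 cpolyC scale1r; exact: invertible1.
rewrite big_cons cpolyM; apply: invertibleM; last first.
  by apply: IH => d dr; apply: qT; rewrite inE dr orbT.
rewrite cpolyX_sub -opprB -scaleN1r; apply/invertibleZ.
  by rewrite oppr_eq0 oner_eq0.
by apply: qT; rewrite inE eqxx.
Qed.

Lemma bop_polyE p T : bop_poly p T = cpoly (map_poly (real_complex R) p) T.
Proof.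
rewrite /bop_poly /cpoly size_map_poly.
by apply: eq_bigr => k _; rewrite coef_map.
Qed.

Lemma bop_polyB p1 p2 T : bop_poly (p1 - p2) T = bop_poly p1 T - bop_poly p2 T.
Proof. by rewrite !bop_polyE rmorphB/= cpolyD cpolyN. Qed.

Lemma bop_polyC t T : bop_poly t%:P T = t%:C *: (1 : bop H).
Proof. by rewrite bop_polyE map_polyC/= cpolyC. Qed.

Lemma bop_polyMXaddC p t T :
  bop_poly (p * 'X + t%:P) T = T * bop_poly p T + t%:C *: (1 : bop H).
Proof.
by rewrite !bop_polyE rmorphD rmorphM/= map_polyX map_polyC/= cpolyD cpolyMX cpolyC.
Qed.

Lemma selfadjoint_bop_poly p T : selfadjoint T -> selfadjoint (bop_poly p T).
Proof.
move=> sT; apply: selfadjoint_sum => k.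
exact/selfadjointZ/selfadjointX.
Qed.

(** A linear map that intertwines T and S on the orbit of v up to the degree of p
   intertwines p(T) and p(S) at v. *)
Lemma bop_poly_intertwine (H1 H2 : hilbertType R) (A : {linear H1 -> H2})
    (T : bop H1) (S : bop H2) (p : {poly R}) (v : H1) :
  (forall k, (k < size p)%N -> S (A ((T ^+ k) v)) = A (T ((T ^+ k) v))) ->
  bop_poly p S (A v) = A (bop_poly p T v).
Proof.
move=> h; rewrite /bop_poly !bop_sumE linear_sum; apply: eq_bigr => k _.
rewrite !bopZE linearZ/=; congr (_ *: _).
have : (k < size p)%N by [].
elim: (k : nat) => [//|i IH ip].
by rewrite exprS bopE IH ?(ltnW ip)// h ?(ltnW ip)// exprS.
Qed.

(** Spectral mapping: the real points of the spectrum of p(T) are values of p on the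
   real points of the spectrum of T. *)
Lemma spectrum_bop_poly p T v0 m : selfadjoint T -> v0 != 0 ->
  spectrum (bop_poly p T) m%:C -> exists2 x : R, spectrum T x%:C & p.[x] = m.
Proof.
move=> sT v00 /spectrumP pm; apply: contrapT => nx.
have {}nx (x : R) : spectrum T x%:C -> p.[x] <> m by move=> Tx px; apply: nx; exists x.
apply: pm; rewrite -(bop_polyC m T) -bop_polyB bop_polyE.
(* If m - p is the zero polynomial, any point of the spectrum, which is not empty,
   gives the contradiction. *)
apply: cpoly_invertible.
  rewrite map_poly_eq0; apply/eqP => /eqP; rewrite subr_eq0 => /eqP pm.
  have [a [_ [sa _ _]]] := spectrum_extremes sT v00.
  by apply: (nx a sa); rewrite -pm hornerC.
move=> c rc; apply: contrapT => /spectrumP sc.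
have [M M0 TM] := bop_boundE T.
have [x _ xc] := numrange_spectrum sT (opnorm_numrange TM) sc.
move: rc sc; rewrite -xc rootE horner_map/= => /eqP[] h /nx; apply.
by move: h; rewrite hornerD hornerN hornerC => /eqP; rewrite subr_eq0 => /eqP.
Qed.

Lemma bop_poly_opnorm p T (e : R) : selfadjoint T ->
  (forall x : R, spectrum T x%:C -> `|p.[x]| <= e) ->
  opnorm_le (bop_poly p T) e.
Proof.
move=> sT pe v; have [->|v0] := eqVneq v 0; first by rewrite linear0 hn0 mulr0.
have sP := selfadjoint_bop_poly p sT.
have [a [b [sa sb nP]]] := spectrum_extremes sP v0.
have [x sx xa] := spectrum_bop_poly sT v0 sa.
have [y sy yb] := spectrum_bop_poly sT v0 sb.
have := pe _ sx; rewrite xa => ha; have := pe _ sy; rewrite yb => hb.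
apply: (numrange_norm _ sP); first exact: le_trans ha.
move: ha hb; rewrite !ler_norml => /andP[ha _] /andP[_ hb] w.
have /andP[h1 h2] := nP w; apply/andP; split.
- by apply: le_trans h1; rewrite ler_wpM2r ?sqr_ge0.
- by apply: (le_trans h2); rewrite ler_wpM2r ?sqr_ge0.
Qed.

End PolynomialCalculus.

(** * The continuous functional calculus *)

Section ContinuousCalculus.
Context {R : realType} {H : hilbertType R}.
Implicit Types (x y z v : H) (A B S T h : bop H) (t : R) (c : R[i]).
Implicit Types (p : {poly R}) (q : {poly R[i]}) (f : R -> R).

Lemma is_cfcP f h T : is_cfc f h T <-> forall e, 0 < e -> exists p,
  (forall x : R, spectrum h x%:C -> `|p.[x] - f x| <= e) /\
  opnorm_le (bop_poly p h - T) e.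
Proof.
by split=> cT e /cT[p [pf pT]]; exists p; split => //; exact/opnorm_leP.
Qed.

(** A polynomial within e of f on the spectrum gives an operator within e of f(h), for
   every e and not only for the polynomials used to define f(h). *)
Lemma cfc_approx_spectrum f h T p (e : R) : selfadjoint h -> is_cfc f h T ->
  (forall x : R, spectrum h x%:C -> `|p.[x] - f x| <= e) ->
  opnorm_le (bop_poly p h - T) e.
Proof.
move=> sh /is_cfcP cT pf v; apply/ler_addgt0Pr => d d0.
have hv : 0 < 2 * (hn v + 1) by rewrite mulr_gt0// ltr_wpDl// hn_ge0.
have [p' [pf' pT']] := cT _ (divr_gt0 d0 hv).
set d' := d / _ in pf' pT'.
have : opnorm_le (bop_poly (p - p') h) (e + d').
  apply: bop_poly_opnorm => // x sx; rewrite hornerD hornerN.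
  have -> : p.[x] - p'.[x] = (p.[x] - f x) - (p'.[x] - f x) by ring.
  by rewrite (le_trans (ler_normB _ _))// lerD// ?pf ?pf'.
rewrite bop_polyB => h1.
have -> : bop_poly p h - T = (bop_poly p h - bop_poly p' h) + (bop_poly p' h - T).
  by rewrite subrKA.
apply: le_trans (opnorm_leD h1 pT' v) _.
have -> : (e + d' + d') * hn v = e * hn v + d' * (2 * hn v) by ring.
rewrite lerD2l /d' mulrAC ler_pdivrMr// ler_pM2l//.
by rewrite mulrDr lerDl mulr1.
Qed.

(** For f continuous on a segment that contains the spectrum of h, the operator cfc f h
   satisfies its defining relation instead of being the default value 0. *)
Lemma cfcP (a b : R) f h : a <= b -> {within `[a, b], continuous f} ->
  selfadjoint h -> spectrum h `<=` real_set `[a, b] -> is_cfc f h (cfc f h).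
Proof.
move=> ab cf sh sab.
suff [T cT] : exists T, is_cfc f h T by exact: (xgetPex 0 (ex_intro _ T cT)).
have inab (x : R) : spectrum h x%:C -> x \in `[a, b].
  by move=> /sab [y yab /complexI <-].
have /choice[P PP] : forall n : nat, exists p : {poly R}, forall x : R, x \in `[a, b] ->
    `|p.[x] - f x| <= n.+1%:R^-1.
  by move=> n; apply: weierstrass.
have Pd e : 0 < e -> exists N, forall n, (N <= n)%N ->
    forall x : R, x \in `[a, b] -> `|(P n).[x] - f x| <= e.
  move=> e0; exists (Num.truncn e^-1) => n Nn x xab.
  apply: (le_trans (PP n x xab)); rewrite -[leRHS]invrK lef_pV2 ?posrE ?invr_gt0//.
  by apply: (le_trans (ltW (truncnS_gt _))); rewrite ler_nat.
have [T TP] : exists T, forall e, 0 < e -> exists N, forall n, (N <= n)%N ->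
    opnorm_le (bop_poly (P n) h - T) e.
  apply: (@bop_complete _ _ (fun n => bop_poly (P n) h)) => e e0.
  have e2 : 0 < e / 2 by rewrite divr_gt0.
  have [N NP] := Pd _ e2; exists N => n Nn; rewrite -bop_polyB.
  apply: bop_poly_opnorm => // x /inab xab; rewrite hornerD hornerN.
  have -> : (P N).[x] - (P n).[x] = ((P N).[x] - f x) - ((P n).[x] - f x) by ring.
  by rewrite (le_trans (ler_normB _ _))// [leRHS]splitr lerD// NP.
exists T; apply/is_cfcP => e e0.
have [N1 NP1] := Pd _ e0; have [N2 NP2] := TP _ e0.
exists (P (maxn N1 N2)); split.
- by move=> x /inab; apply: NP1; exact: leq_maxl.
- by apply: NP2; exact: leq_maxr.
Qed.

Lemma cfc_approx (a b : R) f h p (e : R) : a <= b ->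
  {within `[a, b], continuous f} ->
  selfadjoint h -> spectrum h `<=` real_set `[a, b] ->
  (forall x : R, x \in `[a, b] -> `|p.[x] - f x| <= e) ->
  opnorm_le (bop_poly p h - cfc f h) e.
Proof.
move=> ab cf sh sab pf; apply: cfc_approx_spectrum sh (cfcP ab cf sh sab) _.
by move=> x /sab [y yab /complexI <-]; exact: pf.
Qed.

Lemma cfc_qform_approx (a b : R) f h p (e : R) v : a <= b ->
  {within `[a, b], continuous f} ->
  selfadjoint h -> spectrum h `<=` real_set `[a, b] ->
  (forall x : R, x \in `[a, b] -> `|p.[x] - f x| <= e) ->
  `|qform (bop_poly p h) v - qform (cfc f h) v| <= e * hn v ^+ 2.
Proof.
move=> ab cf sh sab pf; rewrite -qformB ler_norml -mulNr.
exact: opnorm_numrange (cfc_approx ab cf sh sab pf) v.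
Qed.

(** The imaginary part of (u, w) is the real part of (- i u, w), so the real inner
   product suffices to test self-adjointness. *)
Lemma rin_selfadjoint T : (forall x y, rin (T x) y = rin x (T y)) -> selfadjoint T.
Proof.
move=> sT x y.
have innerE u w : inner u w = rin u w +i* rin (- 'i%C *: u) w.
  rewrite /rin linearZl_LR/=; case: (inner u w) => a b /=.
  by apply/eqP; rewrite eq_complex/=; apply/andP; split; apply/eqP; ring.
by rewrite !innerE -linearZ/= !sT.
Qed.

Lemma cfc_selfadjoint f h T : selfadjoint h -> is_cfc f h T -> selfadjoint T.
Proof.
move=> sh /is_cfcP cT; apply: rin_selfadjoint => x y.
apply/eqP; rewrite -subr_eq0 -normr_le0; apply/ler_addgt0Pr => d d0; rewrite add0r.
have hv : 0 < 2 * (hn x * hn y + 1) by rewrite mulr_gt0// ltr_wpDl// mulr_ge0// hn_ge0.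
have [p [_ pT]] := cT _ (divr_gt0 d0 hv).
have sp : rin (bop_poly p h x) y = rin x (bop_poly p h y).
  by apply: selfadjoint_rin; exact: selfadjoint_bop_poly.
have -> : rin (T x) y - rin x (T y) =
   rin x ((bop_poly p h - T) y) - rin ((bop_poly p h - T) x) y.
  by rewrite !bopE rinDr rinDl rinNr rinNl sp; ring.
set e := d / _ in pT.
apply: (@le_trans _ _ (e * (2 * (hn x * hn y)))).
  apply: le_trans (ler_normB _ _) _.
  have -> : e * (2 * (hn x * hn y)) = hn x * (e * hn y) + (e * hn x) * hn y by ring.
  apply: lerD; apply: le_trans (normr_rin_le _ _) _.
  - by apply: ler_wpM2l; [exact: hn_ge0 | exact: pT].
  - by apply: ler_wpM2r; [exact: hn_ge0 | exact: pT].
rewrite /e mulrAC ler_pdivrMr// ler_pM2l//.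
by rewrite mulrDr lerDl mulr1.
Qed.

End ContinuousCalculus.

(** * Lower limits of real sequences *)

Section LowerLimits.
Context {R : realType}.

Lemma limn_einf_lt_frequently (u : nat -> R) (c : R) :
  (limn_einf (EFin \o u) < c%:E)%E -> forall N, exists2 n, (N <= n)%N & u n < c.
Proof.
move=> uc N; have : (einfs (EFin \o u) N < c%:E)%E.
  apply: le_lt_trans uc; rewrite limn_einf_lim (cvg_lim _ (@cvg_einfs_sup _ _))//.
  by apply: ereal_sup_ubound; exists N.
by move=> /ereal_inf_lt [_ [n /= Nn <-]]; rewrite lte_fin => un; exists n.
Qed.

Lemma lt_fin_between (l : \bar R) (x : R) : (l < x%:E)%E ->
  exists2 c : R, (l < c%:E)%E & c < x.
Proof.
case: l => [r| |] //= rx.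
- by rewrite lte_fin in rx; exists ((r + x) / 2); [rewrite lte_fin|]; lra.
- by exists (x - 1); [rewrite ltNyr | lra].
Qed.

Lemma limn_einf_le (u : nat -> R) (c : R) : (forall n, u n <= c) ->
  (limn_einf (EFin \o u) <= c%:E)%E.
Proof.
move=> uc; rewrite leNgt; apply/negP; rewrite limn_einf_lim => cu.
have := cu; rewrite ltNge => /negP; apply.
apply: lime_le; first exact: is_cvg_einfs.
apply: nearW => n; apply: (@le_trans _ _ (u n)%:E); last by rewrite lee_fin.
by apply: ereal_inf_lbound; exists n => /=.
Qed.

End LowerLimits.

(** * Weak limits and Mazur's theorem *)

Section WeakLimits.
Context {R : realType} {H : hilbertType R}.
Implicit Types (x y z v : H) (A B S T h k : bop H) (t : R).

Lemma Re_cvg {T : Type} {F : set_system T} {FF : Filter F} (u : T -> R[i]) (l : R[i]) :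
  u @ F --> l -> complex.Re (u t) @[t --> F] --> complex.Re l.
Proof.
move=> /cvgrPdist_le ul; apply/cvgrPdist_le => e e0.
have e0' : 0 < (e%:C : R[i]) by rewrite ltcR.
apply: filterS (ul _ e0') => t; rewrite -ReN -ReD -lecR.
exact/le_trans/normc_ge_Re.
Qed.

Lemma weak_cvg_rin (h_ : nat -> bop H) h x y : weak_cvg h_ h ->
  rin (h_ n x) y @[n --> \oo] --> rin (h x) y.
Proof. by move=> /(_ x y) /Re_cvg. Qed.

Lemma weak_cvg_selfadjoint (h_ : nat -> bop H) h :
  (forall n, selfadjoint (h_ n)) -> weak_cvg h_ h -> selfadjoint h.
Proof.
move=> sh wh; apply: rin_selfadjoint => x y; rewrite [RHS]rinC.
have c1 := @weak_cvg_rin h_ h x y wh; have c2 := @weak_cvg_rin h_ h y x wh.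
have E : (fun n => rin (h_ n x) y) = (fun n => rin (h_ n y) x).
  by apply/funext => n; rewrite (selfadjoint_rin x y (sh n)) rinC.
by rewrite E in c1; exact: (cvg_unique _ c1 c2).
Qed.

Lemma weak_cvg_numrange (h_ : nat -> bop H) h (a b : R) :
  (forall n, numrange a b (h_ n)) -> weak_cvg h_ h -> numrange a b h.
Proof.
move=> nh wh v; rewrite qformE; apply/andP; split.
- apply: (cvgr_to_ge (@weak_cvg_rin h_ h v v wh)).
  by apply: nearW => n; have /andP[] := nh n v.
- apply: (cvgr_to_le (@weak_cvg_rin h_ h v v wh)).
  by apply: nearW => n; have /andP[] := nh n v.
Qed.

Lemma numrange_opnorm (a b : R) T : selfadjoint T -> numrange a b T ->
  opnorm_le T (`|a| + `|b|).
Proof.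
move=> sT nT; apply: numrange_norm => // v.
have /andP[h1 h2] := nT v; apply/andP; split.
- apply: le_trans h1; rewrite ler_wpM2r ?sqr_ge0// lerNl.
  by rewrite (le_trans _ (ler_wpDr _ (lexx _)))// -normrN ler_norm.
- apply: (le_trans h2); rewrite ler_wpM2r ?sqr_ge0//.
  by rewrite (le_trans (ler_norm b))// lerDr.
Qed.

(** A form of Mazur's theorem for operators: if a convex set G contains infinitely many
   terms of a bounded weakly convergent sequence, then the limit is approximated by
   elements of G on any finite list of vectors. *)
Lemma mazur_strong_approximation (G : set (bop H)) (h_ : nat -> bop H) h (M : R) :
  (forall S T u, G S -> G T -> 0 <= u <= 1 -> G (u%:C *: S + (1 - u)%:C *: T)) ->
  (forall N, exists2 n, (N <= n)%N & G (h_ n)) ->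
  (forall n, opnorm_le (h_ n - h) M) -> 0 <= M -> weak_cvg h_ h ->
  forall (ws : seq H) (e : R), 0 < e ->
    exists2 k, G k & \sum_(w <- ws) hn ((k - h) w) ^+ 2 < e.
Proof.
move=> Gc Gh hM M0 wh ws e e0; apply: contrapT => nG.
pose Q k := \sum_(w <- ws) hn ((k - h) w) ^+ 2.
have Q0 k : 0 <= Q k by apply: sumr_ge0 => w _; exact: sqr_ge0.
pose B := \sum_(w <- ws) M ^+ 2 * hn w ^+ 2.
have B0 : 0 <= B by apply: sumr_ge0 => w _; rewrite mulr_ge0 ?sqr_ge0.
have QB n : Q (h_ n) <= B.
  by apply: ler_sum => w _; rewrite -hn_le2//; exact: hM.
pose E := [set Q k | k in G]; pose q := inf E.
have [n0 _ Gn0] := Gh 0%N.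
have E0 : E !=set0 by exists (Q (h_ n0)), (h_ n0).
have Ee : lbound E e.
  move=> _ [k Gk <-]; rewrite leNgt; apply/negP => Qk.
  by apply: nG; exists k.
have Elb : has_lbound E by exists e.
have q0 : 0 < q by apply: lt_le_trans e0 _; exact: lb_le_inf.
have qQ k : G k -> q <= Q k by move=> Gk; apply: ge_inf => //; exists k.
(* If the infimum q of Q on G were positive, moving from a near minimizer k a
   fraction u towards a late term h_n would bring Q below q: the cross terms tend to 0
   by weak convergence, and this u makes u^2 B + (1 - u)^2 q < q. *)
pose u := q / (q + B).
have qB0 : 0 < q + B by rewrite ltr_pwDl.
have u0 : 0 < u by rewrite divr_gt0.
have u1 : u <= 1 by rewrite ler_pdivrMr// mul1r lerDl.
have uE : u * (q + B) = q by rewrite divfK// gt_eqF.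
have cross k (d : R) : 0 < d -> exists2 n, G (h_ n) &
    \sum_(w <- ws) rin ((h_ n - h) w) ((k - h) w) <= d.
  move=> d0.
  have c : \sum_(w <- ws) rin (h_ n w) ((k - h) w) @[n --> \oo] -->
      \sum_(w <- ws) rin (h w) ((k - h) w).
    apply: cvg_big => [|w _]; first exact: add_continuous.
    exact: weak_cvg_rin.
  move/cvgrPdist_le : c => /(_ _ d0) [N _ NP].
  have [n Nn Gn] := Gh N; exists n => //.
  have := NP n Nn; rewrite distrC -sumrB; apply: le_trans.
  apply: le_trans (ler_norm _); apply: ler_sum => w _.
  by rewrite bopBE rinDl rinNl.
have step k (d : R) : 0 < d -> G k -> q <= u ^+ 2 * B + (1 - u) ^+ 2 * Q k + d.
  move=> d0 Gk; have d2 : 0 < d / 2 by rewrite divr_gt0.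
  have [n Gn cn] := cross k _ d2.
  have Gnk : G (u%:C *: h_ n + (1 - u)%:C *: k) by apply: Gc => //; rewrite (ltW u0).
  apply: (le_trans (qQ _ Gnk)).
  have -> : Q (u%:C *: h_ n + (1 - u)%:C *: k) = u ^+ 2 * Q (h_ n) +
     2 * (u * (1 - u)) * (\sum_(w <- ws) rin ((h_ n - h) w) ((k - h) w)) +
     (1 - u) ^+ 2 * Q k.
    rewrite /Q !mulr_sumr -!big_split/=; apply: eq_bigr => w _.
    have -> : u%:C *: h_ n w + (1 - u)%:C *: k w - h w =
        u%:C *: (h_ n w - h w) + (1 - u)%:C *: (k w - h w).
      rewrite !scalerBr addrACA -opprD -scalerDl -rmorphD/=.
      by rewrite addrCA subrr addr0 scale1r.
    by rewrite (hn2D (u%:C *: _)) !hn2Z rinZl rinZr; ring.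
  have := QB n; move: (Q (h_ n)) (Q k) => Qn Qk QnB.
  have h1 : u ^+ 2 * Qn <= u ^+ 2 * B by rewrite ler_pM2l// exprn_gt0.
  move: cn; move: (\sum_(w <- ws) _) => s sd.
  have h2 : 0 <= u * (1 - u) by rewrite mulr_ge0 ?subr_ge0// ltW.
  have h3 : u * (1 - u) <= 1 by nra.
  have h4 : 2 * (u * (1 - u)) * s <= d by nra.
  lra.
have infstep (d : R) : 0 < d -> q <= u ^+ 2 * B + (1 - u) ^+ 2 * q + d.
  move=> d0; have d2 : 0 < d / 2 by rewrite divr_gt0.
  have [_ [k Gk <-] kq] : exists2 z, E z & z < q + d / 2.
    by apply: inf_adherent => //; split.
  have := step k _ d2 Gk; have : (1 - u) ^+ 2 <= 1 by nra.
  have : 0 <= (1 - u) ^+ 2 by exact: sqr_ge0.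
  move: (Q k) kq => Qk kq; move: ((1 - u) ^+ 2) => r r0 r1.
  have : r * Qk <= r * q + d / 2 by nra.
  lra.
have : q <= u ^+ 2 * B + (1 - u) ^+ 2 * q.
  by apply/ler_addgt0Pr => d /infstep.
have : u ^+ 2 * B + (1 - u) ^+ 2 * q = q - 2 * (u * q) + u * (u * (q + B)) by ring.
move=> ->; rewrite uE; have : 0 < u * q by rewrite mulr_gt0.
lra.
Qed.

(** Strong continuity of k |-> p(k) v on bounded sets, in a quantitative form: the
   vectors ws are the values at v of the Horner tails of p at h. *)
Lemma bop_poly_strong (p : {poly R}) h v (M : R) : 0 <= M ->
  exists (ws : seq H) (C : R), 0 <= C /\ forall k, opnorm_le k M ->
    hn (bop_poly p k v - bop_poly p h v) ^+ 2 <=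
    C * \sum_(w <- ws) hn ((k - h) w) ^+ 2.
Proof.
move=> M0; elim/poly_ind: p => [|p t [ws [C [C0 CP]]]].
  exists [::], 0; split => // k _.
  by rewrite -polyC0 !bop_polyC subrr hn0 expr0n mul0r.
exists (bop_poly p h v :: ws), (2 * M ^+ 2 * C + 2); split.
  by rewrite addr_ge0// !mulr_ge0// sqr_ge0.
move=> k kM; rewrite !bop_polyMXaddC !bopE.
set w0 := bop_poly p h v; set u := bop_poly p k v.
have -> : k u + t%:C *: v - (h w0 + t%:C *: v) = k (u - w0) + (k - h) w0.
  by rewrite opprD addrACA subrr addr0 linearB bopBE subrKA.
rewrite big_cons; set Q := \sum_(w <- ws) _.
have Q0 : 0 <= Q by apply: sumr_ge0 => w _; exact: sqr_ge0.
apply: (le_trans (hn2D_le _ _)).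
have h1 : hn (k (u - w0)) ^+ 2 <= M ^+ 2 * (C * Q).
  apply: (@le_trans _ _ (M ^+ 2 * hn (u - w0) ^+ 2)); first by rewrite -hn_le2.
  by rewrite ler_wpM2l ?sqr_ge0// CP.
have := sqr_ge0 (hn ((k - h) w0)); move: (hn ((k - h) w0) ^+ 2) => r r0.
have h2 : 0 <= M ^+ 2 * C * r by rewrite mulr_ge0// mulr_ge0// sqr_ge0.
nra.
Qed.

Lemma numrange_convex (a b : R) S T u : numrange a b S -> numrange a b T ->
  0 <= u <= 1 -> numrange a b (u%:C *: S + (1 - u)%:C *: T).
Proof.
move=> nS nT /andP[u0 u1] v; rewrite qformD !qformZ.
have /andP[s1 s2] := nS v; have /andP[t1 t2] := nT v.
by apply/andP; split; nra.
Qed.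

End WeakLimits.

(** * Operator convexity implies weak lower semicontinuity *)

Section Forward.
Context {R : realType} {H : hilbertType R}.
Implicit Types (h k : bop H) (f : R -> R).

Theorem operator_convex_weakly_lsc (a b : R) f (h_ : nat -> bop H) h v : a <= b ->
  {within `[a, b], continuous f} -> operator_convex `[a, b] f ->
  (forall n, selfadjoint (h_ n) /\ spectrum (h_ n) `<=` real_set `[a, b]) ->
  weak_cvg h_ h ->
  ((qform (cfc f h) v)%:E <= limn_einf (fun n => (qform (cfc f (h_ n)) v)%:E))%E.
Proof.
move=> ab cf fconv hh wh.
have sh n := (hh n).1; have specn n := (hh n).2.
have nh n := spectrum_numrange (sh n) (specn n).
have s := weak_cvg_selfadjoint sh wh; have nr := weak_cvg_numrange nh wh.
have sp := numrange_spectrum s nr.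
rewrite leNgt; apply/negP => /lt_fin_between [c lc cv].
have freq := limn_einf_lt_frequently lc.
(* The convex set to which Mazur's theorem is applied. *)
pose G := [set k : bop H | [/\ selfadjoint k, numrange a b k & qform (cfc f k) v <= c]].
have GP k : G k -> [/\ selfadjoint k, numrange a b k & spectrum k `<=` real_set `[a, b]].
  by move=> [sk nk _]; split => //; exact: numrange_spectrum.
have Gconv S T u : G S -> G T -> 0 <= u <= 1 -> G (u%:C *: S + (1 - u)%:C *: T).
  move=> GS GT u01; have [sS nS eS] := GP _ GS; have [sT nT eT] := GP _ GT.
  have [_ _ cS] := GS; have [_ _ cT] := GT.
  have sST : selfadjoint (u%:C *: S + (1 - u)%:C *: T).
    by apply: selfadjointD; exact: selfadjointZ.
  have nST := numrange_convex nS nT u01.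
  split => //; have := fconv _ _ _ _ sS sT eS eT u01 v.
  have eST := numrange_spectrum sST nST.
  have sfS := cfc_selfadjoint sS (cfcP ab cf sS eS).
  have sfT := cfc_selfadjoint sT (cfcP ab cf sT eT).
  have sfST := cfc_selfadjoint sST (cfcP ab cf sST eST).
  rewrite !selfadjoint_inner_real//; last first.
    by apply: selfadjointD; exact: selfadjointZ.
  rewrite lecR qformD !qformZ => /le_trans; apply; case/andP: u01 => u0 u1.
  nra.
have Gh N : exists2 n, (N <= n)%N & G (h_ n).
  have [n Nn hnc] := freq N; exists n => //; split => //; exact: ltW.
pose M := `|a| + `|b|; have M0 : 0 <= M by rewrite addr_ge0.
have hM n : opnorm_le (h_ n - h) (M + M).
  by apply: opnorm_leD; [|apply: opnorm_leN]; exact: numrange_opnorm.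
have maz := mazur_strong_approximation Gconv Gh hM (addr_ge0 M0 M0) wh.
(* The gap g is split in quarters: two for replacing f by p at h and at k, one for
   moving from h to k. *)
pose g := qform (cfc f h) v - c.
have g0 : 0 < g by rewrite subr_gt0.
pose W := hn v; have W0 : 0 <= W := hn_ge0 v.
pose e := g / (4 * (W ^+ 2 + 1)).
have e0 : 0 < e by rewrite divr_gt0// mulr_gt0// ltr_wpDl// sqr_ge0.
have eW : e * W ^+ 2 <= g / 4.
  have -> : g / 4 = e * (W ^+ 2 + 1).
    by rewrite /e; field; rewrite gt_eqF// ltr_wpDl// sqr_ge0.
  by rewrite ler_pM2l// lerDl.
pose d := g / (4 * (W + 1)).
have d0 : 0 < d by rewrite divr_gt0// mulr_gt0// ltr_wpDl.
have dW : d * W <= g / 4.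
  have -> : g / 4 = d * (W + 1) by rewrite /d; field; rewrite gt_eqF// ltr_wpDl.
  by rewrite ler_pM2l// lerDl.
have [p pf] := weierstrass ab cf e0.
have [ws [C [C0 CP]]] := bop_poly_strong p h v M0.
have C1 : 0 < C + 1 by rewrite ltr_wpDl.
have [|k Gk kws] := maz ws (d ^+ 2 / (C + 1)); first by rewrite divr_gt0// exprn_gt0.
have [sk nk ek] := GP _ Gk; have [_ _ ck] := Gk.
have kd : hn (bop_poly p k v - bop_poly p h v) <= d.
  rewrite -ler_sqr ?nnegrE ?hn_ge0 ?(ltW d0)//.
  apply: (le_trans (CP k (numrange_opnorm sk nk))).
  have : (C + 1) * \sum_(w <- ws) hn ((k - h) w) ^+ 2 <= d ^+ 2.
    by rewrite mulrC -ler_pdivlMr// ltW.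
  apply: le_trans; rewrite ler_wpM2r ?lerDl//.
  by apply: sumr_ge0 => w _; exact: sqr_ge0.
have := cfc_qform_approx v ab cf s sp pf.
have := cfc_qform_approx v ab cf sk ek pf.
rewrite -/W !ler_norml => /andP[_ h1] /andP[h2 _].
have h3 : qform (bop_poly p h) v - qform (bop_poly p k) v <= d * W.
  rewrite !qformE -rinNl -rinDl; apply: (le_trans (rin_le _ _)).
  by rewrite ler_wpM2r// hnBC.
have : g = qform (cfc f h) v - c by [].
lra.
Qed.

End Forward.

(** * Orthonormal families and partial isometries *)

Section PartialIsometries.
Context {R : realType}.
Implicit Types (m n : nat).

(** The partial isometry that maps e_i to f_i for i < m, when the families are
   orthonormal. Families are indexed by nat and only their first m terms matter. *)
Definition ptrans {H1 H2 : hilbertType R} m (e : nat -> H1) (f : nat -> H2) (x : H1) : H2 :=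
  \sum_(i < m) inner x (e i) *: f i.

(** The first m terms of e are orthonormal. *)
Definition orthonormal_family {H : hilbertType R} m (e : nat -> H) :=
  forall i j, (i < m)%N -> (j < m)%N -> inner (e i) (e j) = (i == j)%:R.

(** The first m terms of e are orthogonal to the first m terms of f. *)
Definition orthogonal_families {H : hilbertType R} m (e f : nat -> H) :=
  forall i j, (i < m)%N -> (j < m)%N -> inner (e i) (f j) = 0.

Section PTransLinear.
Context {H1 H2 : hilbertType R}.
Implicit Types (e : nat -> H1) (f : nat -> H2).

Lemma ptrans_linear m e f : linear (ptrans m e f).
Proof.
move=> a x y; rewrite /ptrans scaler_sumr -big_split/=; apply: eq_bigr => i _.
by rewrite linearDl linearZl_LR/= scalerDl scalerA.
Qed.

HB.instance Definition _ m e f := GRing.isLinear.Build R[i] H1 H2 _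
  (ptrans m e f) (ptrans_linear m e f).

Lemma ptrans_adj m e f x y :
  inner (ptrans m e f x) y = inner x (ptrans m f e y).
Proof.
rewrite /ptrans inner_suml inner_sumr; apply: eq_bigr => i _.
by rewrite linearZl_LR linearZr_LR/= mulrC -innerC.
Qed.

End PTransLinear.

Lemma ptrans_comp {H1 H2 H3 : hilbertType R} m (e : nat -> H1) (f : nat -> H2) (g : nat -> H3) x :
  orthonormal_family m f -> ptrans m f g (ptrans m e f x) = ptrans m e g x.
Proof.
move=> of_; rewrite {1 3}/ptrans; apply: eq_bigr => i _; congr (_ *: _).
rewrite inner_suml (bigD1 i)//= linearZl_LR/= of_// eqxx mulr1 big1 ?addr0// => j ji.
by rewrite linearZl_LR/= of_// (_ : (j == i :> nat) = false) ?mulr0//; exact: negbTE.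
Qed.

Lemma ptrans_orthogonal {H1 H2 H3 : hilbertType R} m (e : nat -> H1) (f f' : nat -> H2) (g : nat -> H3) x :
  orthogonal_families m f f' -> ptrans m f' g (ptrans m e f x) = 0.
Proof.
move=> of_; rewrite {1}/ptrans big1// => i _.
by rewrite inner_suml big1 ?scale0r// => j _; rewrite linearZl_LR/= of_ ?mulr0.
Qed.

Lemma orthogonal_familiesC {H : hilbertType R} m (e f : nat -> H) :
  orthogonal_families m e f -> orthogonal_families m f e.
Proof. by move=> ef i j im jm; rewrite innerC ef// conjC0. Qed.

(** A finite list of vectors lies in the range of the projection onto the span of a
   finite orthonormal family. *)
Lemma gram_schmidt {H : hilbertType R} (ws : seq H) :
  exists m (u : nat -> H), orthonormal_family m u /\
  forall w, w \in ws -> ptrans m u u w = w.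
Proof.
elim: ws => [|w ws [m [u [ou uws]]]]; first by exists 0%N, (fun=> 0).
pose w' := w - ptrans m u u w.
have [w'0|w'0] := eqVneq w' 0.
  exists m, u; split => // z; rewrite inE => /predU1P[->|]; last exact: uws.
  by apply/esym/eqP; rewrite -subr_eq0 -/w' w'0.
have ortho x : inner (ptrans m u u x) w' = 0.
  rewrite /w' linearBr/= ptrans_adj -[in X in _ - X]ptrans_adj.
  by rewrite ptrans_comp// ptrans_adj subrr.
have ou' i : (i < m)%N -> inner (u i) w' = 0.
  move=> im; suff E : ptrans m u u (u i) = u i by rewrite -E ortho.
  rewrite /ptrans (bigD1 (Ordinal im))//= ou// eqxx scale1r big1 ?addr0// => j ji.
  have /negbTE ji' : i != j by rewrite eq_sym.
  by rewrite ou// ji' scale0r.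
have hw := hn_gt0 w'0.
pose e := (hn w')^-1%:C *: w'.
have inner_e x : inner x e = (hn w')^-1%:C * inner x w'.
  rewrite linearZr_LR/=; congr (_ * _).
  by apply: conj_Creal; rewrite complex_real.
have inner_ww : inner w w' = (hn w' ^+ 2)%:C.
  have -> : w = ptrans m u u w + w' by rewrite addrC subrK.
  by rewrite linearDl/= ortho add0r inner_hn.
have ee : inner e e = 1.
  rewrite inner_hn hnZ ger0_norm ?invr_ge0 ?hn_ge0// mulVf ?gt_eqF//.
  by rewrite expr1n.
exists m.+1, (fun i => if (i < m)%N then u i else e); split.
  move=> i j; rewrite !ltnS leq_eqVlt => /predU1P[->|im];
    rewrite leq_eqVlt => /predU1P[->|jm]; rewrite ?ltnn ?im ?jm ?eqxx.
  - by [].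
  - by rewrite innerC inner_e ou'// mulr0 conjC0 gtn_eqF.
  - by rewrite inner_e ou'// mulr0 ltn_eqF.
  - exact: ou.
have sumE z : ptrans m.+1 (fun i => if (i < m)%N then u i else e)
    (fun i => if (i < m)%N then u i else e) z = ptrans m u u z + inner z e *: e.
  rewrite {1}/ptrans big_ord_recr/= ltnn; congr (_ + _).
  by apply: eq_bigr => i _; rewrite ltn_ord.
move=> z; rewrite sumE inE => /predU1P[->|zws].
- rewrite inner_e inner_ww scalerA -!rmorphM/=.
  have -> : (hn w')^-1 * hn w' ^+ 2 * (hn w')^-1 = 1 by field; rewrite gt_eqF.
  by rewrite scale1r addrC subrK.
- have oz : inner z w' = 0 by rewrite -(uws _ zws) ortho.
  by rewrite uws// inner_e oz mulr0 scale0r addr0.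
Qed.

End PartialIsometries.

(** * Block operators *)

Section Compression.
Context {R : realType} {H K : hilbertType R} (m : nat) (u : nat -> H)
  (ou : orthonormal_family m u).
Implicit Types (e f : nat -> K) (T : bop H) (x y : K) (v w : H).

Lemma ptrans_bounded (H1 H2 : hilbertType R) (e : nat -> H1) (f : nat -> H2) :
  exists2 M : R, 0 <= M & forall x : H1, hn (ptrans m e f x) <= M * hn x.
Proof.
exists (\sum_(i < m) hn (e i) * hn (f i)) => [|x].
  by apply: sumr_ge0 => i _; rewrite mulr_ge0// hn_ge0.
apply: (le_trans (hn_sum _ _)); rewrite mulr_suml; apply: ler_sum => i _.
rewrite hn_scale mulrAC ler_wpM2r ?hn_ge0//.
by rewrite mulrC cauchy_schwarz.
Qed.

(** For orthonormal u and e: T, compressed to the span of u, transported along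
   u_i |-> e_i, and extended by 0 on the orthogonal complement of the e_i. *)
Definition compress_fun e T (x : K) : K := ptrans m u e (T (ptrans m e u x)).

Lemma compress_linear e T : linear (compress_fun e T).
Proof. by move=> a x y; rewrite /compress_fun linearP (linearP T) linearP. Qed.

Lemma compress_bounded e T :
  exists M : R, forall x, `|compress_fun e T x| <= M%:C * `|x|.
Proof.
have [M1 M10 h1] := ptrans_bounded e u; have [M2 M20 h2] := ptrans_bounded u e.
have [M M0 h] := bop_boundE T.
exists (M2 * (M * M1)) => x; rewrite !normE -rmorphM lecR.
apply: (le_trans (h2 _)); rewrite -mulrA ler_wpM2l//.
by apply: (le_trans (h _)); rewrite -mulrA ler_wpM2l.
Qed.

Definition compress e T : bop K := Bop (compress_linear e T) (compress_bounded e T).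

Lemma compress_inner e T x y :
  inner (compress e T x) y = inner (T (ptrans m e u x)) (ptrans m e u y).
Proof. by rewrite [LHS]ptrans_adj. Qed.

Lemma compress_selfadjoint e T : selfadjoint T -> selfadjoint (compress e T).
Proof.
by move=> sT x y; rewrite compress_inner sT [inner x _]innerC compress_inner -innerC.
Qed.

(** Only finitely many coordinates of x and y enter, which reduces weak convergence of
   compressions to the convergence of coordinates. *)
Lemma compress_innerE e T x y : inner (compress e T x) y =
  \sum_(i < m) \sum_(j < m) inner x (e j) * inner (T (u j)) (u i) * inner (e i) y.
Proof.
rewrite compress_inner {2}/ptrans inner_sumr; apply: eq_bigr => i _.
rewrite linearZr_LR/= -innerC mulrC -mulr_suml; congr (_ * _).
rewrite /ptrans linear_sum inner_suml; apply: eq_bigr => j _.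
by rewrite linearZ/= linearZl_LR.
Qed.

(** For orthonormal u and mutually orthogonal orthonormal e and f: the operator on K that
   acts as the compression of T1 on the span of e, as the compression of T2 on the span
   of f, and as the scalar a on the orthogonal complement of both. *)
Definition block_op (a : R) e f T1 T2 : bop K :=
  a%:C *: (1 : bop K) + (compress e (T1 - a%:C *: (1 : bop H))
   + compress f (T2 - a%:C *: (1 : bop H))).

Lemma block_op_selfadjoint a e f T1 T2 : selfadjoint T1 -> selfadjoint T2 ->
  selfadjoint (block_op a e f T1 T2).
Proof.
move=> s1 s2; apply: selfadjointD; first exact/selfadjointZ/selfadjoint1.
have s1a : selfadjoint (- (a%:C *: (1 : bop H))).
  exact/selfadjointN/selfadjointZ/selfadjoint1.
by apply: selfadjointD; apply: compress_selfadjoint; apply: selfadjointD.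
Qed.

(** The Bessel inequality for two mutually orthogonal orthonormal families. The
   coefficients of x are measured through the orthonormal family u of H. *)
Lemma bessel2 e f x : orthonormal_family m e -> orthonormal_family m f ->
  orthogonal_families m e f ->
  hn (ptrans m e u x) ^+ 2 + hn (ptrans m f u x) ^+ 2 <= hn x ^+ 2.
Proof.
move=> oe of_ oef.
pose a := ptrans m e e x; pose b := ptrans m f f x.
have hnE e' : orthonormal_family m e' ->
    rin x (ptrans m e' e' x) = hn (ptrans m e' u x) ^+ 2 /\
    hn (ptrans m e' e' x) ^+ 2 = hn (ptrans m e' u x) ^+ 2.
  by move=> oe'; rewrite -!rinE /rin !ptrans_adj !ptrans_comp.
have [a1 a2] := hnE _ oe; have [b1 b2] := hnE _ of_.
have ab : rin a b = 0.
  by rewrite /rin /a /b ptrans_adj ptrans_orthogonal ?linear0r//; exact: orthogonal_familiesC.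
have := sqr_ge0 (hn (x - a - b)).
rewrite hn2B hn2B rinDl rinNl ab a1 a2 b1 b2.
lra.
Qed.

Lemma block_op_numrange (a b : R) e f T1 T2 : a <= b -> orthonormal_family m e ->
  orthonormal_family m f -> orthogonal_families m e f ->
  numrange a b T1 -> numrange a b T2 -> numrange a b (block_op a e f T1 T2).
Proof.
move=> ab oe of_ oef n1 n2 x.
have qE e' T : qform (compress e' (T - a%:C *: (1 : bop H))) x =
    qform T (ptrans m e' u x) - a * hn (ptrans m e' u x) ^+ 2.
  by rewrite /qform compress_inner -[LHS]/(qform _ _) qformB qformZ1.
rewrite !qformD qformZ1 !qE.
have /andP[l1 r1] := n1 (ptrans m e u x).
have /andP[l2 r2] := n2 (ptrans m f u x).
have := bessel2 x oe of_ oef.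
move: l1 r1 l2 r2.
move: (hn (ptrans m e u x) ^+ 2) (hn (ptrans m f u x) ^+ 2) (hn x ^+ 2) => p q r.
move: (qform _ _) (qform _ _) => q1 q2 l1 r1 l2 r2 pqr.
have : 0 <= (b - a) * (r - (p + q)) by rewrite mulr_ge0// subr_ge0.
by move=> h; apply/andP; split; lra.
Qed.

(** The span of e is invariant under the block operator, which acts there as the
   compression of T1; nothing is lost at the vectors fixed by the projection onto
   the span of u. *)
Lemma block_op_intertwine (a : R) e f T1 T2 v : orthonormal_family m e ->
  orthogonal_families m e f -> ptrans m u u v = v ->
  block_op a e f T1 T2 (ptrans m u e v) = ptrans m u e (T1 v).
Proof.
move=> oe oef uy; rewrite !bopDE bopZE bop1E.
rewrite -[compress f _ _]/(compress_fun _ _ _) -[compress e _ _]/(compress_fun _ _ _).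
rewrite /compress_fun ptrans_comp// ptrans_orthogonal// !linear0 addr0 uy.
by rewrite bopBE bopZE bop1E linearB linearZ/= addrC subrK.
Qed.

Lemma block_op_intertwine_r (a : R) e f T1 T2 v : orthonormal_family m f ->
  orthogonal_families m e f -> ptrans m u u v = v ->
  block_op a e f T1 T2 (ptrans m u f v) = ptrans m u f (T2 v).
Proof.
move=> oe oef uy; rewrite /block_op [X in _ + X]addrC.
by apply: block_op_intertwine => //; exact: orthogonal_familiesC.
Qed.

End Compression.

(** * The standard basis of the space of square-summable sequences *)

Section StandardBasis.
Context {R : realType}.

(** The k-th vector of the standard basis, as a sequence. *)
Definition delta_fun (k : nat) : nat -> R[i] := fun j => (j == k)%:R.

Lemma delta_series k n : series (fun j => sqmod (delta_fun k j)) n = (k < n)%:R.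
Proof.
elim: n => [|n IH]; first by rewrite /series/= big_geq.
rewrite /series/= big_nat_recr//= -[X in X + _]/(series _ n) IH /delta_fun (eq_sym n).
have -> : (k < n.+1)%N = (k == n) || (k < n)%N by rewrite ltnS leq_eqVlt.
case: eqVneq => [->|nk]; rewrite /sqmod.
  by rewrite ltnn ComplexField.Normc.normc1 expr1n add0r.
by rewrite ComplexField.Normc.normc0 expr0n addr0.
Qed.

Lemma delta_l2 k : delta_fun k \in @l2_pred R.
Proof.
apply/asboolP; apply: (proj1 (@sqsum_bounded R _ 1 _)) => n.
by rewrite delta_series; case: (k < n)%N.
Qed.

(** The k-th vector of the standard basis. *)
Definition delta k : l2 R := L2 (delta_l2 k).

Lemma inner_delta (x : l2 R) k : inner x (delta k) = x k.
Proof.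
rewrite -[LHS]/(l2_inner x (delta k)); apply: cvg_lim => //.
apply: cvg_near_cst; exists k.+1 => // n /= kn.
have : (k < n)%N by [].
elim: n {kn} => // n IH; rewrite /series/= big_nat_recr//= -[X in X + _]/(series _ n).
rewrite ltnS leq_eqVlt => /predU1P[->|kn].
  rewrite {1}/series/= big_nat_cond big1 => [|i /andP[/andP[_ ik] _]].
    by rewrite /delta_fun eqxx conjC1 mulr1 add0r.
  by rewrite /delta_fun ltn_eqF// conjC0 mulr0.
by rewrite IH// /delta_fun gtn_eqF// conjC0 mulr0 addr0.
Qed.

Lemma delta_orthonormal i j : inner (delta i) (delta j) = (i == j)%:R.
Proof. by rewrite inner_delta/= /delta_fun eq_sym. Qed.

Lemma l2_coord_cvg0 (x : l2 R) (e : R) : 0 < e ->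
  exists n0, forall n, (n0 <= n)%N -> `|x n| <= e%:C.
Proof.
move=> e0; have := cvg_series_cvg_0 (@l2_summable R x).
move/cvgrPdist_le => /(_ (e ^+ 2)); rewrite exprn_gt0// => /(_ isT) [n0 _ n0P].
exists n0 => n /n0P /=; rewrite sub0r normrN ger0_norm ?sqmod_ge0// /sqmod.
rewrite ler_sqr ?nnegrE ?(ltW e0)//; last by case: (x n) => a b; exact: sqrtr_ge0.
by rewrite -lecR.
Qed.

(** A vector in the plane of delta_i and delta_(N + i). For c^2 + d^2 = 1 the families
   tilt c d N and tilt d (- c) N are orthonormal and orthogonal to each other on the
   indices below N. *)
Definition tilt (c d : R) (N : nat) (i : nat) : l2 R :=
  c%:C *: delta i + d%:C *: delta (N + i).

Lemma inner_tilt c d c' d' m N i j : (m <= N)%N -> (i < m)%N -> (j < m)%N ->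
  inner (tilt c d N i) (tilt c' d' N j) = (c * c' + d * d')%:C * (i == j)%:R.
Proof.
move=> mN im jm; rewrite /tilt !innerDl !innerDr !inner_realZr !innerZl.
rewrite !delta_orthonormal eqn_add2l.
rewrite (ltn_eqF (leq_trans im (leq_trans mN (leq_addr _ _)))).
rewrite (gtn_eqF (leq_trans jm (leq_trans mN (leq_addr _ _)))).
by rewrite rmorphD !rmorphM/= !mulr0n; ring.
Qed.

(** Weakly, only the component of a tilted vector along delta_i survives when N tends
   to infinity. *)
Lemma inner_tilt_cvg (x : l2 R) c d m i :
  inner x (tilt c d (m + n) i) @[n --> \oo] --> c%:C * inner x (delta i).
Proof.
apply/cvgrPdist_le => -[e1 e2]; rewrite ltcE/= => /andP[/eqP -> e0].
have d0 : 0 < `|d| + 1 by rewrite ltr_wpDl.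
have [n0 n0P] := l2_coord_cvg0 x (divr_gt0 e0 d0).
exists n0 => // n nn0; rewrite /tilt innerDr !inner_realZr !inner_delta.
rewrite opprD addNKr normrN normrM.
have := n0P (m + n + i)%N (leq_trans nn0 (leq_trans (leq_addl _ _) (leq_addr _ _))).
have nd : `|d%:C : R[i]| = `|d|%:C.
  by rewrite normc_def/= expr0n addr0 sqrtr_sqr.
move=> h; rewrite nd; apply: (@le_trans _ _ (`|d|%:C * (e1 / (`|d| + 1))%:C)).
  by rewrite ler_wpM2l// ler0c.
rewrite -rmorphM complexr0 lecR mulrCA ler_piMr ?(ltW e0)//.
by rewrite ler_pdivrMr// mul1r lerDl.
Qed.

End StandardBasis.

(** * Weak lower semicontinuity implies operator convexity *)

Section Backward.
Context {R : realType}.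
Implicit Types (f : R -> R).

(** The quadratic forms of f(h) are weakly lower semicontinuous in h, along sequences
   of self-adjoint operators on l^2 with a <= h <= b. *)
Definition weakly_lsc (a b : R) f :=
  forall (h_ : nat -> bop (l2 R)) (h : bop (l2 R)),
    (forall n, selfadjoint (h_ n)) -> (forall n, numrange a b (h_ n)) ->
    selfadjoint h -> numrange a b h -> weak_cvg h_ h ->
    forall v : l2 R,
      ((qform (cfc f h) v)%:E <= limn_einf (fun n => (qform (cfc f (h_ n)) v)%:E))%E.

Lemma tilt10 N : tilt 1 0 N = @delta R.
Proof. by apply/funext => i; rewrite /tilt scale1r scale0r addr0. Qed.

Lemma tilt_decomposition (c d : R) N i : c ^+ 2 + d ^+ 2 = 1 ->
  delta i = c%:C *: tilt c d N i + d%:C *: tilt d (- c) N i.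
Proof.
move=> cd; rewrite /tilt !scalerDr !scalerA -!rmorphM addrACA -!scalerDl -!rmorphD/=.
rewrite -!expr2 cd mulrN (mulrC c d) subrr scale1r scale0r addr0//.
Qed.

Lemma inner_tilt_cvg_l (y : l2 R) c d m i :
  inner (tilt c d (m + n) i) y @[n --> \oo] --> c%:C * inner (delta i) y.
Proof.
have /cvgrPdist_le h := @inner_tilt_cvg R y c d m i.
apply/cvgrPdist_le => e /h; apply: filterS => n.
have -> : c%:C * inner (delta i) y - inner (tilt c d (m + n) i) y =
    Num.conj (c%:C * inner y (delta i) - inner y (tilt c d (m + n) i)).
  by rewrite -innerZl -inner_realZr rmorphB/= -!innerC.
by rewrite norm_conjC.
Qed.

(** Block operators along tilted families converge weakly to a block operator that acts
   as the convex combination c^2 h1 + d^2 h2 on the first block and as the scalar a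
   elsewhere. *)
Lemma block_op_weak_cvg (H : hilbertType R) m (u : nat -> H) (a c d : R)
    (h1 h2 : bop H) : c ^+ 2 + d ^+ 2 = 1 ->
  weak_cvg (fun n => block_op m u a (tilt c d (m + n)) (tilt d (- c) (m + n)) h1 h2)
    (block_op m u a (@delta R) (tilt 0 1 m)
       ((c ^+ 2)%:C *: h1 + (d ^+ 2)%:C *: h2) (a%:C *: (1 : bop H))).
Proof.
move=> cd x y; rewrite /block_op subrr.
under eq_fun do rewrite !bopDE bopZE bop1E !innerDl !compress_innerE.
rewrite !bopDE bopZE bop1E !innerDl !compress_innerE.
have lim (c' d' : R) (T : bop H) :
    \sum_(i < m) \sum_(j < m) inner x (tilt c' d' (m + n) j) *
      inner (T (u j)) (u i) * inner (tilt c' d' (m + n) i) y @[n --> \oo] -->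
    \sum_(i < m) \sum_(j < m) (c'%:C * inner x (delta j)) *
      inner (T (u j)) (u i) * (c'%:C * inner (delta i) y).
  apply: cvg_big => [|i _]; first exact: add_continuous.
  apply: cvg_big => [|j _]; first exact: add_continuous.
  apply: cvgM; last exact: inner_tilt_cvg_l.
  by apply: cvgM; [exact: inner_tilt_cvg | exact: cvg_cst].
apply: cvgD; first exact: cvg_cst.
set L := (X in _ --> X).
have -> : L =
    (\sum_(i < m) \sum_(j < m) (c%:C * inner x (delta j)) *
      inner ((h1 - a%:C *: (1 : bop H)) (u j)) (u i) * (c%:C * inner (delta i) y)) +
    (\sum_(i < m) \sum_(j < m) (d%:C * inner x (delta j)) *
      inner ((h2 - a%:C *: (1 : bop H)) (u j)) (u i) * (d%:C * inner (delta i) y)).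
  rewrite /L [X in _ + X]big1 ?addr0 => [|i _]; last first.
    by rewrite big1// => j _; rewrite bop0E linear0l mulr0 mul0r.
  rewrite -big_split/=; apply: eq_bigr => i _; rewrite -big_split/=.
  apply: eq_bigr => j _.
  rewrite !innerBl !innerDl !innerZl.
  have cd' : (a%:C : R[i]) = a%:C * (c%:C * c%:C) + a%:C * (d%:C * d%:C).
    by rewrite -mulrDr -!rmorphM -rmorphD/= -!expr2 cd mulr1.
  by rewrite {1}cd' !rmorphXn/=; ring.
by apply: cvgD; exact: lim.
Qed.

Theorem weakly_lsc_convex (a b : R) f (H : hilbertType R) (h1 h2 : bop H) (s : R) :
  a <= b -> {within `[a, b], continuous f} -> weakly_lsc a b f ->
  selfadjoint h1 -> selfadjoint h2 -> numrange a b h1 -> numrange a b h2 ->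
  0 <= s <= 1 ->
  bop_le (cfc f (s%:C *: h1 + (1 - s)%:C *: h2))
         (s%:C *: cfc f h1 + (1 - s)%:C *: cfc f h2).
Proof.
move=> ab cf lsc s1 s2 n1 n2 s01 v; have /andP[s0 s1'] := s01.
set k := _ + _ *: h2.
have sk : selfadjoint k by apply: selfadjointD; exact: selfadjointZ.
have nk : numrange a b k by exact: numrange_convex.
have e1 := numrange_spectrum s1 n1; have e2 := numrange_spectrum s2 n2.
have ek := numrange_spectrum sk nk.
have f1 := cfc_selfadjoint s1 (cfcP ab cf s1 e1).
have f2 := cfc_selfadjoint s2 (cfcP ab cf s2 e2).
have fk := cfc_selfadjoint sk (cfcP ab cf sk ek).
rewrite !selfadjoint_inner_real//; last by apply: selfadjointD; exact: selfadjointZ.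
rewrite lecR qformD !qformZ; apply/ler_addgt0Pr => e0 e00.
pose W := hn v; have W0 : 0 <= W := hn_ge0 v.
pose e := e0 / (4 * (W ^+ 2 + 1)).
have ep : 0 < e by rewrite divr_gt0// mulr_gt0// ltr_wpDl// sqr_ge0.
have eW : e * W ^+ 2 <= e0 / 4.
  have -> : e0 / 4 = e * (W ^+ 2 + 1).
    by rewrite /e; field; rewrite gt_eqF// ltr_wpDl// sqr_ge0.
  by rewrite ler_pM2l// lerDl.
have [p pf] := weierstrass ab cf ep.
(* The vectors that p sees; the exponent size p is included so that v itself is
   always among them. *)
pose orb (T : bop H) := mkseq (fun i => (T ^+ i) v) (size p).+1.
have [m [u [ou uw]]] := gram_schmidt (orb h1 ++ orb h2 ++ orb k).
have orbP (T : bop H) i : (i <= size p)%N -> (T ^+ i) v \in orb T.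
  by move=> ip; apply/mapP; exists i => //; rewrite mem_iota add0n ltnS.
have fix1 i : (i <= size p)%N -> ptrans m u u ((h1 ^+ i) v) = (h1 ^+ i) v.
  by move=> ip; apply: uw; rewrite !mem_cat orbP.
have fix2 i : (i <= size p)%N -> ptrans m u u ((h2 ^+ i) v) = (h2 ^+ i) v.
  by move=> ip; apply: uw; rewrite !mem_cat orbP// orbT.
have fixk i : (i <= size p)%N -> ptrans m u u ((k ^+ i) v) = (k ^+ i) v.
  by move=> ip; apply: uw; rewrite !mem_cat orbP// !orbT.
have fixv : ptrans m u u v = v by have := fix1 0%N (leq0n _); rewrite expr0.
pose c := Num.sqrt s; pose d := Num.sqrt (1 - s).
have c2 : c ^+ 2 = s by rewrite sqr_sqrtr.
have d2 : d ^+ 2 = 1 - s by rewrite sqr_sqrtr// subr_ge0.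
have cd : c ^+ 2 + d ^+ 2 = 1 by rewrite c2 d2 addrC subrK.
pose ep' n := @tilt R c d (m + n); pose et n := @tilt R d (- c) (m + n).
have oep n : orthonormal_family m (ep' n).
  move=> i j im jm; rewrite (inner_tilt _ _ _ _ (leq_addr n m) im jm) -!expr2 cd.
  by rewrite mul1r.
have oet n : orthonormal_family m (et n).
  move=> i j im jm; rewrite (inner_tilt _ _ _ _ (leq_addr n m) im jm) mulrNN -!expr2.
  by rewrite addrC cd mul1r.
have oepet n : orthogonal_families m (ep' n) (et n).
  move=> i j im jm; rewrite (inner_tilt _ _ _ _ (leq_addr n m) im jm).
  by rewrite mulrN (mulrC c) subrr mul0r.
have ode : orthonormal_family m (@delta R).
  by move=> i j _ _; exact: delta_orthonormal.
have o01 : orthonormal_family m (@tilt R 0 1 m).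
  by move=> i j im jm; rewrite (inner_tilt _ _ _ _ (leqnn m) im jm) mul0r mulr1 add0r mul1r.
have od01 : orthogonal_families m (@delta R) (@tilt R 0 1 m).
  move=> i j im jm; rewrite -(tilt10 m) (inner_tilt _ _ _ _ (leqnn m) im jm).
  by rewrite mul0r mulr0 addr0 mul0r.
pose h_ n := block_op m u a (ep' n) (et n) h1 h2.
(* The second family is needed to match the shape of the block operators only: on it
   h acts as a, as it does on the complement. *)
pose h := block_op m u a (@delta R) (tilt 0 1 m) k (a%:C *: (1 : bop H)).
have sh_ n : selfadjoint (h_ n) by exact: block_op_selfadjoint.
have sa : selfadjoint (a%:C *: (1 : bop H)) by exact/selfadjointZ/selfadjoint1.
have sh : selfadjoint h by exact: block_op_selfadjoint.
have nh_ n : numrange a b (h_ n) by exact: block_op_numrange.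
have na : numrange a b (a%:C *: (1 : bop H)).
  by move=> x; rewrite qformZ1 lexx/= ler_wpM2r// sqr_ge0.
have nh : numrange a b h by exact: block_op_numrange.
have wh : weak_cvg h_ h.
  by have := @block_op_weak_cvg H m u a c d h1 h2 cd; rewrite c2 d2.
(* The copy of v in the first block; it does not depend on n. *)
pose w := ptrans m u (@delta R) v.
have wE n : w = c%:C *: ptrans m u (ep' n) v + d%:C *: ptrans m u (et n) v.
  rewrite /w /ptrans !scaler_sumr -big_split/=; apply: eq_bigr => i _.
  rewrite (tilt_decomposition (m + n) i cd) scalerDr !scalerA.
  by rewrite (mulrC c%:C) (mulrC d%:C).
have hw : hn w ^+ 2 = W ^+ 2.
  by rewrite -!rinE /rin /w ptrans_adj ptrans_comp// fixv.
have q_k : qform (bop_poly p h) w = qform (bop_poly p k) v.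
  rewrite /qform /w (@bop_poly_intertwine _ _ _ _ k) => [|i ip]; last first.
    by apply: block_op_intertwine => //; apply: fixk; exact: ltnW.
  by rewrite ptrans_adj ptrans_comp// fixv.
have q_n n : qform (bop_poly p (h_ n)) w =
    s * qform (bop_poly p h1) v + (1 - s) * qform (bop_poly p h2) v.
  have adj1 y : rin (ptrans m u (ep' n) y) w = c * rin y v.
    rewrite /rin ptrans_adj (wE n) linearD !linearZ/= ptrans_comp// fixv.
    rewrite ptrans_orthogonal; last exact: orthogonal_familiesC.
    rewrite scaler0 addr0.
    by rewrite inner_realZr ReZ.
  have adj2 y : rin (ptrans m u (et n) y) w = d * rin y v.
    rewrite /rin ptrans_adj (wE n) linearD !linearZ/= ptrans_comp// fixv.
    rewrite ptrans_orthogonal; last exact: oepet.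
    rewrite scaler0 add0r.
    by rewrite inner_realZr ReZ.
  rewrite !qformE {1}(wE n) linearD !linearZ/=.
  rewrite (@bop_poly_intertwine _ _ _ _ h1) => [|i ip]; last first.
    by apply: block_op_intertwine => //; apply: fix1; exact: ltnW.
  rewrite (@bop_poly_intertwine _ _ _ _ h2) => [|i ip]; last first.
    by apply: block_op_intertwine_r => //; apply: fix2; exact: ltnW.
  by rewrite rinDl !rinZl adj1 adj2 !mulrA -!expr2 c2 d2.
have := lsc h_ h sh_ nh_ sh nh wh w.
have q1 := cfc_qform_approx v ab cf s1 e1 pf.
have q2 := cfc_qform_approx v ab cf s2 e2 pf.
have qk := cfc_qform_approx v ab cf sk ek pf.
have qh := cfc_qform_approx w ab cf sh (numrange_spectrum sh nh) pf.
have lim : (limn_einf (fun n => (qform (cfc f (h_ n)) w)%:E) <=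
    (s * qform (cfc f h1) v + (1 - s) * qform (cfc f h2) v + e0 / 2)%:E)%E.
  apply: (@limn_einf_le _ (fun n => qform (cfc f (h_ n)) w)) => n.
  have qn := cfc_qform_approx w ab cf (sh_ n) (numrange_spectrum (sh_ n) (nh_ n)) pf.
  move: qn q1 q2; rewrite hw q_n -/W !ler_norml => /andP[l _] /andP[_ l1] /andP[_ l2].
  nra.
move=> /le_trans /(_ lim); rewrite lee_fin => fin.
move: qh qk; rewrite hw q_k -/W !ler_norml => /andP[_ l] /andP[l' _].
lra.
Qed.

End Backward.

(** * Reduction to compact segments *)

Lemma bop_le_trivial {R : realType} {H : hilbertType R} (S T : bop H) :
  (forall v : H, v != 0 -> inner (S v) v <= inner (T v) v) -> bop_le S T.
Proof.
by move=> h v; have [->|/h//] := eqVneq v 0; rewrite !linear0r.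
Qed.

Section Reductions.
Context {R : realType}.
Implicit Types (f : R -> R).

Lemma operator_convex_sub (A B : set R) f : A `<=` B ->
  operator_convex B f -> operator_convex A f.
Proof.
move=> AB fB H h1 h2 s s1 s2 e1 e2 s01; apply: fB => //.
- by apply: subset_trans e1 _ => _ [x Ax <-]; exists x => //; exact: AB.
- by apply: subset_trans e2 _ => _ [x Ax <-]; exists x => //; exact: AB.
Qed.

(** Operator convexity on I follows from operator convexity on the compact segments of
   I: the extreme points of the two numerical ranges lie in I. *)
Lemma operator_convex_local (I : set R) f :
  (forall a b, I a -> I b -> a <= b -> operator_convex `[a, b] f) ->
  operator_convex I f.
Proof.
move=> loc H h1 h2 s s1 s2 e1 e2 s01; apply: bop_le_trivial => v v0.
have [a1 [b1 [ea1 eb1 n1]]] := spectrum_extremes s1 v0.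
have [a2 [b2 [ea2 eb2 n2]]] := spectrum_extremes s2 v0.
have inI h (x : R) : spectrum h `<=` real_set I -> spectrum h x%:C -> I x.
  by move=> eh /eh [y Iy /complexI <-].
have hv : 0 < hn v ^+ 2 by rewrite exprn_gt0// hn_gt0.
have ab1 : a1 <= b1.
  by rewrite -(ler_pM2r hv); have /andP[h1' h2'] := n1 v; exact: le_trans h2'.
have ab2 : a2 <= b2.
  by rewrite -(ler_pM2r hv); have /andP[h1' h2'] := n2 v; exact: le_trans h2'.
(* The smallest segment that contains both numerical ranges. *)
pose a := Num.min a1 a2; pose b := Num.max b1 b2.
have Ia : I a by rewrite /a; case: ltP => _; [exact: inI ea1 | exact: inI ea2].
have Ib : I b by rewrite /b; case: ltP => _; [exact: inI eb2 | exact: inI eb1].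
have aa1 : a <= a1 by rewrite ge_min lexx.
have aa2 : a <= a2 by rewrite ge_min lexx orbT.
have bb1 : b1 <= b by rewrite le_max lexx.
have bb2 : b2 <= b by rewrite le_max lexx orbT.
have ab : a <= b by apply: le_trans aa1 (le_trans ab1 bb1).
have sub (c d : R) : a <= c -> d <= b -> real_set `[c, d] `<=` real_set `[a, b].
  move=> ac db _ [x /= + <-]; rewrite in_itv/= => /andP[cx xd].
  by exists x => //=; rewrite in_itv/= (le_trans ac cx) (le_trans xd db).
apply: (loc a b) => //.
- exact: subset_trans (numrange_spectrum s1 n1) (sub _ _ aa1 bb1).
- exact: subset_trans (numrange_spectrum s2 n2) (sub _ _ aa2 bb2).
Qed.

Lemma weakly_lsc_operator_convex (a b : R) f : a <= b ->
  {within `[a, b], continuous f} -> weakly_lsc a b f -> operator_convex `[a, b] f.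
Proof.
move=> ab cf lsc H h1 h2 s s1 s2 e1 e2 s01.
by apply: (weakly_lsc_convex ab) => //; exact: spectrum_numrange.
Qed.

Lemma delta0_neq0 : @delta R 0 != 0.
Proof.
apply/eqP => d0; have := @delta_orthonormal R 0 0.
by rewrite d0 linear0l => /esym/eqP; rewrite oner_eq0.
Qed.

(** The infimum and the supremum of the union of the spectra lie in its closure, hence
   in I, and they bound all the numerical ranges. *)
Lemma bounded_collection_extremes (I : set R) (h : option nat -> bop (l2 R)) :
  Estarstar_sa h -> Espectrum h `<=` real_set I ->
  exists a b, [/\ I a, I b, a <= b & forall n, numrange a b (h n)].
Proof.
move=> [[M hM] sh] eI.
pose E := [set x : R | exists n, spectrum (h n) x%:C].
have hn_ n : opnorm_le (h n) M by apply/opnorm_leP => v; exact: hM.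
have bnd x : E x -> - M <= x <= M.
  move=> [n sn]; have := numrange_spectrum (sh n) (opnorm_numrange (hn_ n)) sn.
  by move=> [y /= + /complexI <-]; rewrite in_itv.
have E0 n : exists x, spectrum (h n) x%:C.
  by have [a [b [sa _ _]]] := spectrum_extremes (sh n) delta0_neq0; exists a.
have En0 : E !=set0 by have [x sx] := E0 None; exists x, None.
have supE : has_sup E by split => //; exists M => x /bnd /andP[].
have infE : has_inf E by split => //; exists (- M) => x /bnd /andP[].
have clI x : (forall e, 0 < e -> exists2 y, E y & `|x - y| < e) -> I x.
  move=> clx; have : Espectrum h x%:C.
    move=> B /nbhs_ballP [[e1 e2] /=]; rewrite ltcE/= => /andP[/eqP -> e0] eB.
    have [y [n sy] xy] := clx _ e0; exists y%:C; split; first by exists n.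
    apply: eB; rewrite -ball_normE/= -rmorphB/= normc_def/= expr0n addr0 sqrtr_sqr.
    by rewrite complexr0 ltcR.
  by move=> /eI [y Iy /complexI <-].
have Ia : I (inf E).
  apply: clI => e e0; have [y Ey ye] := inf_adherent e0 infE.
  exists y => //; have : inf E <= y by apply: ge_inf => //; exact: infE.2.
  by move=> iy; rewrite ler0_norm ?subr_le0// opprB ltrBlDl.
have Ib : I (sup E).
  apply: clI => e e0; have [y Ey ye] := sup_adherent e0 supE.
  exists y => //; have : y <= sup E by apply: ub_le_sup => //; exact: supE.2.
  by move=> iy; rewrite ger0_norm ?subr_ge0// ltrBlDr -ltrBlDl.
exists (inf E), (sup E); split => //.
- have [x Ex] := En0; apply: (@le_trans _ _ x); first by apply: ge_inf => //; exact: infE.2.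
  by apply: ub_le_sup => //; exact: supE.2.
- move=> n; apply: spectrum_numrange => // lam slam.
  have [y _ yl] := numrange_spectrum (sh n) (opnorm_numrange (hn_ n)) slam.
  exists y => //=; rewrite in_itv/=.
  have Ey : E y by exists n; rewrite yl.
  apply/andP; split; first by apply: ge_inf => //; exact: infE.2.
  by apply: ub_le_sup => //; exact: supE.2.
Qed.

Lemma interval_segment_sub (I : interval R) (a b : R) :
  [set` I] a -> [set` I] b -> `[a, b]%classic `<=` [set` I].
Proof.
move=> Ia Ib x /=; rewrite in_itv/= => /andP[ax xb].
by apply: (@interval_is_interval _ I a b Ia Ib x); rewrite ax.
Qed.

Lemma cfc_opnorm (H : hilbertType R) (a b : R) f : a <= b -> {within `[a, b], continuous f} ->
  exists M : R, forall h : bop H, selfadjoint h -> numrange a b h ->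
    opnorm_le (cfc f h) M.
Proof.
move=> ab cf; have [p pf] := weierstrass ab cf ltr01.
have [M M0 fM] := continuous_segment_bounded cf.
exists ((M + 1) + 1) => h sh nh.
have eh := numrange_spectrum sh nh.
have -> : cfc f h = bop_poly p h - (bop_poly p h - cfc f h) by rewrite subKr.
apply: opnorm_leD; last by apply: opnorm_leN; exact: cfc_approx pf.
apply: bop_poly_opnorm => // x /eh [y yab /complexI <-].
have -> : p.[y] = f y + (p.[y] - f y) by rewrite addrC subrK.
by rewrite (le_trans (ler_normD _ _))// lerD// ?fM// pf.
Qed.

Lemma closure_real_segment (a b : R) (S : set R[i]) :
  S `<=` real_set `[a, b] -> closure S `<=` real_set `[a, b].
Proof.
move=> Sab [l1 l2] clS.
have near e : 0 < e -> exists y : R, [/\ a <= y, y <= b, `|l1 - y| < e & `|l2| < e].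
  move=> e0; have e0' : 0 < (e%:C : R[i]) by rewrite ltcR.
  have [_ [/Sab [y + <-]]] := clS _ (nbhsx_ballx (l1 +i* l2) _ e0').
  rewrite /= in_itv/= => /andP[ay yb]; rewrite -ball_normE/= normc_def/= subr0 ltcR.
  move=> h; exists y; split => //; apply: le_lt_trans h; rewrite -sqrtr_sqr.
  - by rewrite ler_wsqrtr// lerDl sqr_ge0.
  - by rewrite ler_wsqrtr// lerDr sqr_ge0.
have l20 : l2 = 0.
  apply/eqP; rewrite -normr_le0; apply/ler_addgt0Pr => e /near [y [_ _ _ /ltW]].
  by rewrite add0r.
exists l1; last by rewrite l20.
rewrite /= in_itv/=; apply/andP; split; apply/ler_addgt0Pr => e /near [y [ay yb + _]].
- by rewrite ltr_norml => /andP[h1 h2]; lra.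
- by rewrite ltr_norml => /andP[h1 h2]; lra.
Qed.

End Reductions.

Theorem theorem3p1 (R : realType) :
  (forall (a b : R) (f : R -> R), a <= b -> {within `[a, b], continuous f} ->
    (operator_convex `[a, b] f <->
     forall (h_ : nat -> bop (l2 R)) (h : bop (l2 R)),
       (forall n, selfadjoint (h_ n) /\ spectrum (h_ n) `<=` real_set `[a, b]) ->
       weak_cvg h_ h ->
       forall v : l2 R,
         ((qform (cfc f h) v)%:E <=
            limn_einf (fun n => (qform (cfc f (h_ n)) v)%:E))%E))
  /\
  (forall (I : interval R) (f : R -> R), {within [set` I], continuous f} ->
    (operator_convex [set` I] f <->
     forall h : option nat -> bop (l2 R),
       Qset h -> Espectrum h `<=` real_set [set` I] -> Wset (Ecfc f h))).
Proof.
split=> [a b f ab cf|I f cf]; split.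
- by move=> fc h_ h hh wh v; exact: operator_convex_weakly_lsc hh wh.
- move=> lsc; apply: weakly_lsc_operator_convex => // h_ h sh_ nh_ _ _ wh v.
  apply: lsc => // n; split => //; exact: numrange_spectrum.
- move=> fc h [hE wh] eI; have [a [b [Ia Ib ab nh]]] := bounded_collection_extremes hE eI.
  have [_ sh] := hE.
  have sub := interval_segment_sub Ia Ib.
  have cf' := continuous_subspaceW sub cf.
  have fc' := operator_convex_sub sub fc.
  have eh n := numrange_spectrum (sh n) (nh n).
  split; first split.
  + have [M hM] := cfc_opnorm (l2 R) ab cf'; exists M => n v.
    by move: v; apply/opnorm_leP; exact: hM.
  + by move=> n; exact: cfc_selfadjoint (sh n) (cfcP ab cf' (sh n) (eh n)).
  + by move=> v; apply: (operator_convex_weakly_lsc v ab cf' fc').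
- move=> EW; apply: operator_convex_local => a b Ia Ib ab.
  have sub := interval_segment_sub Ia Ib.
  have cf' := continuous_subspaceW sub cf.
  apply: weakly_lsc_operator_convex => // h_ h sh_ nh_ sh nh wh v.
  (* The collection with components h_n and limit component h. *)
  pose g n := if n is Some m then h_ m else h.
  have sg n : selfadjoint (g n) by case: n.
  have ng n : numrange a b (g n) by case: n.
  suff : Wset (Ecfc f g) by move=> [_ /(_ v)].
  apply: EW.
    split=> //; split=> //; exists (`|a| + `|b|) => n.
    by apply/opnorm_leP; exact: numrange_opnorm.
  have gab : \bigcup_n spectrum (g n) `<=` real_set `[a, b].
    by move=> lam [n _]; exact: numrange_spectrum.
  apply: subset_trans (closure_real_segment gab) _ => _ [x xab <-].
  by exists x => //; exact: sub.
Qed.
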